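(* In the two-server system, suppose $\delta\le\epsilon<\frac12$, $\beta\ge2\delta$, and CARD's work threshold is $c=\frac{2m_+}{\beta}\log\frac{3}{2\beta\delta}$ (with $c\ge m_+$). Then \[ \mathbb E[T_{\mathrm{CARD}}]\le\Big(K_{\mathrm{CARD}}+\frac{4\beta}{\alpha+\beta}\Big)\Big(1+\frac{\delta}{\epsilon}\Big)\mathbb E[W_{\mathrm{M/G/1}}]+2\mathbb E[S] +44m_+\max\Big\{\frac{\beta}{\alpha^2(\alpha+\beta)},\ \sqrt{\frac{\beta}{\alpha^2\epsilon(\alpha+\beta)}},\ \frac{\log\frac{3}{2\beta\delta}}{\beta(\alpha+\beta)},\ \sqrt{\frac{\log\frac{3}{2\beta\delta}}{\beta}},\ \frac{\sqrt\delta\,\log\frac{3}{2\beta\delta}}{\alpha^2\beta^2\epsilon}\Big\}. \]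
   Context: Two-server model: servers $1$ (short, work $W_s$) and $2$ (long, work $W_\ell$), each with its own FCFS queue, each completing work at rate $1/2$ while nonempty. Poisson arrivals of rate $\lambda$, i.i.d. job sizes $S$ with continuous distribution and $\mathbb E[S^2]<\infty$; a job of size $s$ sent to a server with work $w$ has response time $2(w+s)$; $\mathbb E[T_{\mathrm{CARD}}]$ is the mean response time under CARD. $\rho=\lambda\mathbb E[S]$, $\epsilon=1-\rho$. CARD with parameters $0\le m_-\le m_+\le c$: jobs of size $<m_-$ go to the short server; jobs of size in $[m_-,m_+)$ go to the short server if $W_s\le c$ at arrival and to the long server otherwise; jobs of size $\ge m_+$ go to the long server. $\rho_s=\lambda\mathbb E[S\mathbf 1(S<m_-)]$, $\rho_m=\lambda\mathbb E[S\mathbf 1(m_-\le S<m_+)]$, $\alpha=\frac12-\rho_s>0$, $\beta=\rho_s+\rho_m-\frac12>0$; $\delta>0$. $\mathbb E[W_{\mathrm{M/G/1}}]=\frac{\lambda\mathbb E[S^2]}{2\epsilon}$. The number $m$ solves $\mathbb E[S\mathbf 1(S<m)]=\frac12\mathbb E[S]$, and $K_{\mathrm{CARD}}=2\mathbb P(S\ge m)$. *)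

(* Defs.v *)
From HB Require Import structures.
From mathcomp Require Import all_boot all_order all_algebra.
From mathcomp Require Import all_classical all_reals all_analysis.
Set Implicit Arguments. Unset Strict Implicit. Unset Printing Implicit Defensive.
Import Order.TTheory GRing.Theory Num.Theory.
Import numFieldNormedType.Exports.
Local Open Scope classical_set_scope.
Local Open Scope ring_scope.

Definition mutually_independent {d} {T : measurableType d} {R : realType}
  (P : probability T R) {I : eqType} (X : I -> T -> R) : Prop :=
  forall (F : seq I) (B : I -> set R), uniq F ->
    (forall i, measurable (B i)) ->
    P (\big[setI/setT]_(i <- F) (X i @^-1` B i)) =
    (\big[*%E/1%E]_(i <- F) P (X i @^-1` B i))%E.

(* The whole input family: interarrival times (inl n) and job sizes (inr n). *)
Definition input_family {T R : Type} (A Sz : nat -> T -> R) : nat + nat -> T -> R :=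
  fun i => match i with inl n => A n | inr n => Sz n end.

Section CARD.
Variable R : realType.

(* CARD routing: true = short server, false = long server.
   ws = short-server work seen at arrival, s = job size. *)
Definition card_to_short (mminus mplus c ws s : R) : bool :=
  (s < mminus) || ((mminus <= s) && (s < mplus) && (ws <= c)).

(* each server completes work at rate 1/2 while nonempty *)
Definition drain (tau w : R) : R := Num.max (w - tau / 2) 0.

(* Work (W_s, W_l) seen by job n just before its arrival; the system starts
   empty at the arrival of job 0, and a n is the time between the arrivals of
   jobs n and n+1; s n is the size of job n. *)
Fixpoint card_state (mminus mplus c : R) (a s : nat -> R) (n : nat) : R * R :=
  match n with
  | 0 => (0, 0)
  | k.+1 =>
    let st := card_state mminus mplus c a s k in
    if card_to_short mminus mplus c st.1 (s k)
    then (drain (a k) (st.1 + s k), drain (a k) st.2)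
    else (drain (a k) st.1, drain (a k) (st.2 + s k))
  end.

Definition card_response (mminus mplus c : R) (a s : nat -> R) (n : nat) : R :=
  let st := card_state mminus mplus c a s n in
  if card_to_short mminus mplus c st.1 (s n)
  then 2 * (st.1 + s n) else 2 * (st.2 + s n).

Definition mean_response {d} {T : measurableType d} (P : probability T R)
  (Tn : nat -> T -> R) : \bar R :=
  limn_esup (fun n => ((n.+1)%:R^-1)%:E *
                      \sum_(k < n.+1) \int[P]_w (Tn k w)%:E)%E.

Definition mean_between {d} {T : measurableType d} (P : probability T R)
  (S : T -> R) (a b : R) : R :=
  fine (\int[P]_w (if (a <= S w) && (S w < b) then S w else 0)%:E).
Definition mean_below {d} {T : measurableType d} (P : probability T R)
  (S : T -> R) (b : R) : R :=
  fine (\int[P]_w (if S w < b then S w else 0)%:E).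
Definition mean {d} {T : measurableType d} (P : probability T R) (S : T -> R) : R :=
  fine (\int[P]_w (S w)%:E).
End CARD.

(* Main.v *)
Require Import Defs.
From HB Require Import structures.
From mathcomp Require Import all_boot all_order all_algebra.
From mathcomp Require Import all_classical all_reals all_analysis.
From mathcomp Require Import measurable_realfun exponential_distribution ring lra.
Set Implicit Arguments.
Unset Strict Implicit.
Unset Printing Implicit Defensive.
Import Order.TTheory GRing.Theory Num.Theory.
Import numFieldNormedType.Exports.
Local Open Scope classical_set_scope.
Local Open Scope ring_scope.

(** Foster-Lyapunov drift arguments for the chain (W_s, W_l) of works seen at
  arrivals. If [f] is nonnegative along the chain, the expected increments of
  [f] over the first N arrivals add up to at least [- f (0, 0)], which bounds
  Cesaro averages without any stationarity or convergence.

  Write x = W_s, y = W_l, u = (x - c)^+, alpha and beta for the downward and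
  upward drifts of x above and below c. The exponential interarrival times turn
  the drift between arrivals into its value at the next arrival (PASTA).
  - [exp (- theta x)] and [y exp (- theta x)] with theta = beta / m_+ show that
    idleness of the short server is negligible, of order delta^2, also when
    weighted by y;
  - [x] gives P(x > c) <= about beta / (alpha + beta), and a cubic in u gives
    E u^2 = O(m_+^2 beta / (alpha^2 (alpha + beta)));
  - [(x + y)^2 / 2 - b (x + y)] gives
    E (x + y) <= (1 + delta / eps) E W_{M/G/1} plus errors;
  - [x y + x^2 / 2] gives (alpha + beta) E (y 1(x > c)) <= beta E y plus errors.
  The mean response time is at most
  2 E S + 2 E x + 2 P(S >= m_+) E y + 2 E (y 1(x > c)). *)

(** * Independence *)

(** Below c the short server gains work at rate beta in jumps smaller than m_+. With theta = beta /
    m_+ a jump changes theta x by at most beta, so the second-order term of exp (- theta x) stays a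
    fraction of the first-order one and the exponential decreases on average. The threshold gives
    theta c = 2 log (3 / (2 beta delta)), so exp (- theta c) = (2 beta delta / 3)^2; its beta^2
    offsets the factor m_+ / beta^2 lost in passing from exp (- theta x) to y 1(x = 0). The obstacle
    is circularity: the idleness of a server is weighted by the work of the other, so the balance of
    x + y contains the mean of y 1(x = 0), which is itself bounded through the mean of y. Every
    summed function is integrable at each arrival, so the sums are finite and the small multiple of
    the sum of y can be moved to the left side; this costs the factor 1 + delta / eps. The idleness
    of the long server, weighted by x, is met by the second moment of the excess of x over c
    instead. As y has only two moments, no Lyapunov function is more than quadratic in y. *)

Section independence.
Context {d} {T : measurableType d} {R : realType} (P : probability T R).

Definition indep_pair {d1 d2} {U : measurableType d1} {V : measurableType d2}
    (X : T -> U) (Y : T -> V) : Prop :=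
  forall B C, measurable B -> measurable C ->
    P (X @^-1` B `&` Y @^-1` C) = (P (X @^-1` B) * P (Y @^-1` C))%E.

(** The positive and the negative part are transported separately, so neither a sign nor
    integrability of [f] has to be known. *)
Lemma integral_law {d1} {V : measurableType d1} (Y : {mfun T >-> V})
    (f : V -> \bar R) : measurable_fun setT f ->
  (\int[distribution P Y]_y f y = \int[P]_w f (Y w))%E.
Proof.
move=> mf; rewrite [LHS]integralE [RHS]integralE; congr (_ - _)%E.
- rewrite (funepos_comp f Y) ge0_integral_distribution//.
  exact: measurable_funepos.
- rewrite (funeneg_comp f Y) ge0_integral_distribution//.
  exact: measurable_funeneg.
Qed.

Lemma integral_ident_distr {d1} {V : measurableType d1} (Y Y' : T -> V)
    (f : V -> \bar R) :
  measurable_fun setT Y -> measurable_fun setT Y' ->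
  (forall B, measurable B -> P (Y @^-1` B) = P (Y' @^-1` B)) ->
  measurable_fun setT f ->
  (\int[P]_w f (Y w) = \int[P]_w f (Y' w))%E.
Proof.
move=> mY mY' YY' mf.
pose Ym : {mfun T >-> V} := HB.pack Y (isMeasurableFun.Build _ _ _ _ _ mY).
pose Ym' : {mfun T >-> V} := HB.pack Y' (isMeasurableFun.Build _ _ _ _ _ mY').
rewrite -(integral_law Ym)// -(integral_law Ym')//.
by apply: eq_measure_integral => B mB _; exact: YY'.
Qed.

(** Independence makes the joint law a product measure, and Fubini's theorem integrates [Y] out at a
    fixed value of [X]. This turns a drift bound at each fixed state into one for means along the
    chain. *)
Lemma indep_integral_le {d1 d2} {U : measurableType d1} {V : measurableType d2}
    (X : T -> U) (Y : T -> V) (phi : U * V -> R) (psi : U -> R) :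
  measurable_fun setT X -> measurable_fun setT Y -> indep_pair X Y ->
  measurable_fun setT phi ->
  P.-integrable setT (EFin \o (fun w => phi (X w, Y w))) ->
  P.-integrable setT (EFin \o (fun w => psi (X w))) ->
  (forall w, \int[P]_w' (phi (X w, Y w'))%:E <= (psi (X w))%:E)%E ->
  \int[P]_w (phi (X w, Y w)) <= \int[P]_w (psi (X w)).
Proof.
move=> mX mY iXY mphi iphi ipsi le.
pose Xm : {mfun T >-> U} := HB.pack X (isMeasurableFun.Build _ _ _ _ _ mX).
pose Ym : {mfun T >-> V} := HB.pack Y (isMeasurableFun.Build _ _ _ _ _ mY).
have mXY : measurable_fun setT (fun w => (X w, Y w)) by exact: measurable_fun_pair.
pose XYm : {mfun T >-> (U * V)%type} :=
  HB.pack (fun w => (X w, Y w)) (isMeasurableFun.Build _ _ _ _ _ mXY).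
have prodE : forall A, measurable A ->
    (distribution P Xm \x distribution P Ym)%E A = distribution P XYm A.
  apply: product_measure_unique => B C mB mC.
  rewrite /distribution /pushforward -iXY//=.
have mphi' : measurable_fun setT (EFin \o phi) by exact/measurable_EFinP.
have iprod : (distribution P Xm \x distribution P Ym)%E.-integrable setT
    (EFin \o phi).
  apply/integrableP; split => //.
  move/integrableP : iphi => [_]; congr (_ < _)%E.
  rewrite -(integral_law XYm (f := abse \o (EFin \o phi))); last exact: measurableT_comp.
  by apply: eq_measure_integral => A mA _; exact/esym/prodE.
have iE : (\int[P]_w (phi (X w, Y w))%:E =
    \int[P]_w \int[P]_w' (phi (X w, Y w'))%:E)%E.
  rewrite -(integral_law XYm (f := EFin \o phi))//.
  transitivity (\int[distribution P Xm]_x fubini_F (distribution P Ym) (EFin \o phi) x)%E.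
    rewrite (integral12_prod_meas1 iprod).
    by apply: eq_measure_integral => A mA _; exact/esym/prodE.
  rewrite (integral_law Xm); last exact: (measurable_fubini_F iprod).
  by apply: eq_integral => w _; rewrite /fubini_F (integral_law Ym)//; exact: (measurableT_comp mphi' (pair1_measurable _)).
have iF : P.-integrable setT (fun w => \int[P]_w' (phi (X w, Y w'))%:E)%E.
  have FE u : fubini_F (distribution P Ym) (EFin \o phi) u =
      (\int[P]_w' (phi (u, Y w'))%:E)%E.
    by rewrite /fubini_F (integral_law Ym)//; exact: (measurableT_comp mphi' (pair1_measurable _)).
  have mF := measurable_fubini_F iprod.
  have /integrableP[_ iF] := integrable_fubini_F iprod.
  apply/integrableP; split.
    rewrite (_ : (fun _ => _) = (fubini_F (distribution P Ym) (EFin \o phi)) \o X);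
      last by apply/funext => w /=; rewrite FE.
    exact: measurableT_comp.
  move: iF; rewrite (integral_law Xm (f := abse \o _)); last exact: measurableT_comp.
  by under eq_integral do rewrite /= FE.
rewrite /Rintegral iE fine_le//.
- exact: integrable_fin_num.
- exact: integrable_fin_num.
- by apply: le_integral => // w _; exact: le.
Qed.
End independence.

(** * Independence of one input from finitely many others *)

Section cylinders.
Context {d} {T : measurableType d} {R : realType} (P : probability T R).
Context {I : eqType} (X : I -> T -> R).
Hypothesis mX : forall i, measurable_fun setT (X i).
Hypothesis indX : mutually_independent P X.

(** A pi-system that generates the events determined by the inputs listed in [L]. Taking one set
    [B i] per index makes closure under intersection immediate. *)
Definition cylinder (L : seq I) : set (set T) :=
  [set E | exists2 B : I -> set R, (forall i, measurable (B i)) &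
           E = \big[setI/setT]_(i <- L) (X i @^-1` B i)].

Lemma cylinder_measurable L : cylinder L `<=` measurable.
Proof.
move=> _ [B mB ->]; apply: big_ind => //; first exact: measurableI.
by move=> i _; rewrite -[X in measurable X]setTI; exact: mX.
Qed.

Lemma cylinder_setI_closed L : setI_closed (cylinder L).
Proof.
move=> _ _ [B mB ->] [C mC ->].
exists (fun i => B i `&` C i); first by move=> i; exact: measurableI.
by rewrite -big_split.
Qed.

Lemma cylinder_setT L : cylinder L setT.
Proof. by exists (fun=> setT) => //; rewrite big1. Qed.

Lemma cylinder_preimage L i (B : set R) : i \in L -> uniq L -> measurable B ->
  cylinder L (X i @^-1` B).
Proof.
move=> iL uL mB; exists (fun k => if k == i then B else setT).
  by move=> k; case: ifP.
rewrite (bigD1_seq i)//= eqxx big1 ?setIT// => k /negbTE ->.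
by rewrite preimage_setT.
Qed.

(** For fixed [C] both sides are finite measures in [E]. They agree on cylinders by mutual
    independence over [j :: L], and uniqueness on a pi-system extends this to the generated
    sigma-algebra. *)
Lemma indep_sigma_cylinder L j E (C : set R) : uniq L -> j \notin L ->
  measurable C -> <<s cylinder L >> E ->
  P (E `&` X j @^-1` C) = (P E * P (X j @^-1` C))%E.
Proof.
move=> uL jL mC.
have mXC : measurable (X j @^-1` C) by rewrite -[X in measurable X]setTI; exact: mX.
have r0 : 0 <= fine (P (X j @^-1` C)) by apply: fine_ge0.
have rE : (NngNum r0)%:num%:E = P (X j @^-1` C).
  by rewrite -[RHS]fineK// fin_num_measure.
have H : forall E, <<s cylinder L >> E ->
    mrestr P mXC E = mscale (NngNum r0) P E.
  apply: (g_sigma_algebra_measure_unique (cylinder L) _ (fun=> setT)) => //.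
  - exact: cylinder_measurable.
  - by move=> _; exact: cylinder_setT.
  - by rewrite bigcup_const//; exists 0.
  - exact: cylinder_setI_closed.
  - move=> _ [B mB ->]; rewrite -[LHS]/(P (_ `&` _)) -[RHS]/((NngNum r0)%:num%:E * P _)%E rE.
    have := @indX (j :: L) (fun i => if i == j then C else B i).
    rewrite /= jL uL => /(_ isT) => H.
    have := @indX L B uL mB => H2.
    have Bij i : i \in L -> (if i == j then C else B i) = B i.
      by case: eqP => // ->; rewrite (negbTE jL).
    rewrite !big_cons eqxx in H.
    have e1 : \big[setI/setT]_(i <- L) (X i @^-1` (if i == j then C else B i)) =
       \big[setI/setT]_(i <- L) (X i @^-1` B i).
      by apply: eq_big_seq => i iL; rewrite Bij.
    have e2 : (\big[*%E/1%E]_(i <- L) (P (X i @^-1` (if i == j then C else B i))) =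
       \big[*%E/1%E]_(i <- L) (P (X i @^-1` B i)))%E.
      by apply: eq_big_seq => i iL; rewrite Bij.
    rewrite e1 e2 -H2 in H.
    by rewrite setIC H// => i; case: ifP.
  - move=> _; rewrite -[X in (X < _)%E]/(P (_ `&` _)).
    by rewrite ltey_eq fin_num_measure//; exact: measurableI.
by move=> /H; rewrite /mrestr => ->; rewrite -[LHS]/((NngNum r0)%:num%:E * P _)%E rE muleC.
Qed.

(** That [Y] is a function of the inputs in [L] is expressed as measurability for the sigma-algebra
    generated by their cylinders. *)
Lemma indep_pair_cylinder L j {d1} {U : measurableType d1} (Y : T -> U) :
  uniq L -> j \notin L ->
  measurable_fun (setT : set (g_sigma_algebraType (cylinder L))) Y ->
  indep_pair P Y (X j).
Proof.
move=> uL jL mY B C mB mC; apply: indep_sigma_cylinder uL jL mC _.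
by have := mY measurableT _ mB; rewrite setTI.
Qed.

Lemma measurable_cylinder_coord L i : uniq L -> i \in L ->
  measurable_fun (setT : set (g_sigma_algebraType (cylinder L))) (X i).
Proof.
move=> uL iL _ B mB; rewrite setTI; apply: sub_sigma_algebra.
exact: cylinder_preimage.
Qed.

End cylinders.

(** * The CARD recursion as alternating jumps and drains *)

Section state.
Context {R : realType}.
Variables (mminus mplus c : R).

Definition drain_state (t : R) (p : R * R) : R * R := (drain t p.1, drain t p.2).

Definition jump (p : R * R) (s : R) : R * R :=
  if card_to_short mminus mplus c p.1 s then (p.1 + s, p.2) else (p.1, p.2 + s).

Lemma card_stateS a s n : card_state mminus mplus c a s n.+1 =
  drain_state (a n) (jump (card_state mminus mplus c a s n) (s n)).
Proof. by rewrite /= /jump; case: ifP. Qed.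

Lemma measurable_card_to_short :
  measurable_fun setT (fun z : R * R => card_to_short mminus mplus c z.1 z.2).
Proof.
apply: measurable_or; first exact: measurable_fun_ltr.
apply: measurable_and; last exact: measurable_fun_ler.
by apply: measurable_and; [exact: measurable_fun_ler|exact: measurable_fun_ltr].
Qed.

Lemma measurable_jump : measurable_fun setT (fun z : (R * R) * R => jump z.1 z.2).
Proof.
have m11 : measurable_fun setT (fun z : (R * R) * R => z.1.1).
  by apply: measurableT_comp.
have m12 : measurable_fun setT (fun z : (R * R) * R => z.1.2).
  by apply: measurableT_comp.
apply: measurable_fun_ifT.
- exact: (measurableT_comp measurable_card_to_short
    (measurable_fun_pair m11 measurable_snd)).
- apply: measurable_fun_pair => //; exact: measurable_funD.
- apply: measurable_fun_pair => //; exact: measurable_funD.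
Qed.

Lemma measurable_drain : measurable_fun setT (fun z : R * R => drain z.1 z.2).
Proof.
apply: measurable_maxr => //; apply: measurable_funB => //.
exact: (measurable_funM).
Qed.

Lemma measurable_drain_state :
  measurable_fun setT (fun z : (R * R) * R => drain_state z.2 z.1).
Proof.
have m11 : measurable_fun setT (fun z : (R * R) * R => z.1.1).
  by apply: measurableT_comp.
have m12 : measurable_fun setT (fun z : (R * R) * R => z.1.2).
  by apply: measurableT_comp.
apply: measurable_fun_pair.
- exact: (measurableT_comp measurable_drain (measurable_fun_pair measurable_snd m11)).
- exact: (measurableT_comp measurable_drain (measurable_fun_pair measurable_snd m12)).
Qed.

(** The space is arbitrary and only inputs of index below [n] are assumed measurable, so that the
    lemma also applies to the sigma-algebra of the first inputs; this yields the independence of the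
    state from the next input. *)
Lemma measurable_card_state {d} {T : measurableType d} (A S : nat -> T -> R) n :
  (forall i, (i < n)%N -> measurable_fun setT (A i)) ->
  (forall i, (i < n)%N -> measurable_fun setT (S i)) ->
  measurable_fun setT
    (fun w => card_state mminus mplus c (A ^~ w) (S ^~ w) n).
Proof.
elim: n => [|n IH] mA mS; first exact: measurable_cst.
under eq_fun do rewrite card_stateS.
have mX : measurable_fun setT
    (fun w => card_state mminus mplus c (A ^~ w) (S ^~ w) n).
  by apply: IH => i ni; [apply: mA|apply: mS]; rewrite ltnS ltnW.
have mJ := measurableT_comp measurable_jump (measurable_fun_pair mX (mS n (ltnSn n))).
exact: (measurableT_comp measurable_drain_state (measurable_fun_pair mJ (mA n (ltnSn n)))).
Qed.
End state.

(** * Exponential interarrival times *)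

Section exponential_integral.
Context {R : realType} (rate : R).
Hypothesis rate0 : 0 < rate.
Local Notation mu := (@lebesgue_measure R).

Lemma exponential_prob_dom : exponential_prob rate `<< mu.
Proof.
apply/null_content_dominatesP => A mA muA0.
apply/eqP; rewrite /exponential_prob/=.
rewrite (null_set_integral mA)//=.
by apply/measurable_funTS/measurable_EFinP; exact: measurable_exponential_pdf.
Qed.

(** The exponential density agrees almost everywhere with the Radon-Nikodym derivative of the law
    with respect to Lebesgue measure. *)
Lemma integral_exponential_prob (f : R -> \bar R) :
  (exponential_prob rate).-integrable setT f ->
  (\int[exponential_prob rate]_x f x =
   \int[mu]_x (f x * (exponential_pdf rate x)%:E))%E.
Proof.
move=> intf.
rewrite -(Radon_Nikodym_change_of_variables exponential_prob_dom)//=.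
have mf := measurable_int _ intf.
apply: ae_eq_integral => //.
- apply: emeasurable_funM => //; apply: (measurable_int mu).
  by apply: Radon_Nikodym_integrable; exact: exponential_prob_dom.
- apply: emeasurable_funM => //=; apply/measurableT_comp => //=.
  exact: measurable_exponential_pdf.
- apply: ae_eqe_mul2l => /=.
  rewrite Radon_NikodymE//=; first exact: exponential_prob_dom.
  move=> abmu; case: cid => /= h [h1 h2 h3].
  apply: integral_ae_eq => //=.
  + by apply/measurableT_comp =>//; exact: measurable_exponential_pdf.
  + by move=> E E01 mE; rewrite -h3.
Qed.

End exponential_integral.

Section exponential_rv.
Context {d} {T : measurableType d} {R : realType} (P : probability T R).
Variables (rate : R) (Y : T -> R).
Hypotheses (rate0 : 0 < rate) (mY : measurable_fun setT Y).
Hypothesis Y0 : forall w, 0 <= Y w.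
Hypothesis tailY : forall t, 0 <= t -> P [set w | t < Y w] = (expR (- (rate * t)))%:E.
Local Notation mu := (@lebesgue_measure R).

(** The rays []x, +oo[] form a pi-system generating the Borel sets, so the tail determines the
    law. *)
Lemma exponential_lawE B : measurable B ->
  P (Y @^-1` B) = exponential_prob rate B.
Proof.
pose Ym : {mfun T >-> measurableTypeR R} :=
  HB.pack Y (isMeasurableFun.Build _ _ T (measurableTypeR R) _ mY).
move=> mB; rewrite -[LHS]/(distribution P Ym B).
apply: (@measure_unique _ R (measurableTypeR R) (@RGenOInfty.G R) (fun n => `]-(n%:R), +oo[%classic)) => //.
- exact: RGenOInfty.measurableE.
- move=> _ _ [x ->] [y ->]; exists (Num.max x y).
  by apply/seteqP; split => z; rewrite /= !in_itv/= !andbT gt_max => /andP.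
- by move=> n; exists (- n%:R).
- apply/seteqP; split => // x _; exists (Num.bound `|x|) => //=.
  rewrite in_itv/= andbT ltrNl; apply: le_lt_trans (archi_boundP (normr_ge0 x)).
  by rewrite -normrN ler_norm.
- move=> _ [x ->]; rewrite /distribution /pushforward /=.
  have e t : 0 <= t -> exponential_prob rate `]t, +oo[ = (expR (- (rate * t)))%:E.
    move=> t0; rewrite /exponential_prob.
    have mEex : measurable_fun setT (EFin \o exponential_pdf rate).
      by apply/measurable_EFinP; exact: measurable_exponential_pdf.
    rewrite integral_itv_obnd_cbnd; last exact: measurable_funTS.
    have cexp : continuous (fun x : R => - expR (- rate * x)).
      move=> z; apply: cvgN.
      apply: continuous_comp; last exact: continuous_expR.
      exact: mulrl_continuous.
    rewrite (@ge0_continuous_FTC2y _ _ (fun x => - (expR (- rate * x))) _ 0)//.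
    - by rewrite sub0e -EFinN opprK mulNr.
    - by move=> z _; apply: exponential_pdf_ge0; exact: ltW.
    - apply: (@continuous_subspaceW R^o _ _ [set` `[0, +oo[%R]).
        by apply: subset_itvr; rewrite bnd_simp.
      exact: within_continuous_exponential_pdf.
    - rewrite -oppr0; apply: cvgN.
      rewrite (_ : (fun x => expR (- rate * x)) =
                   (fun z => expR (- z)) \o (fun z => rate * z)); last first.
        by apply: eq_fun => z; rewrite mulNr.
      apply: (@cvg_comp _ _ _ _ _ _ (pinfty_nbhs R)); last exact: cvgr_expR.
      exact: gt0_cvgMry.
    - by apply: cvg_at_right_filter; exact: cexp.
    - move=> z; rewrite in_itv/= andbT => tx; apply: derive1_exponential_pdf.
      by rewrite in_itv/= andbT; exact: le_lt_trans tx.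
  have Px t : 0 <= t -> P (Y @^-1` `]t, +oo[) = (expR (- (rate * t)))%:E.
    move=> t0; rewrite -tailY//; congr (P _).
    by apply/seteqP; split => w /=; rewrite in_itv/= andbT.
  case: (leP 0 x) => x0; first by rewrite e//; exact: Px.
  (* For negative [x] the ray contains []0, +oo[], which already has mass 1 under both laws. *)
  have prob1 (Q : probability (measurableTypeR R) R) :
      Q `]0, +oo[%classic = 1%E -> Q `]x, +oo[%classic = 1%E.
    move=> Q1; apply/eqP; rewrite eq_le probability_le1//= -Q1.
    apply: le_measure; rewrite ?inE//.
    by apply: subset_itvr; rewrite bnd_simp ltW.
  rewrite -[LHS]/(distribution P Ym _) prob1; last first.
    by rewrite -[LHS]/(P _) Px// mulr0 oppr0 expR0.
  apply/esym/prob1; have := e 0 (lexx _); rewrite mulr0 oppr0 expR0; exact.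
- by move=> n; rewrite ltey_eq fin_num_measure.
Qed.

(** The cut at [tau] keeps [phi] on a compact interval, where continuity alone makes it bounded and
    hence integrable. *)
Lemma exponential_integral_itv (phi : R -> R) (tau : R) : 0 <= tau -> continuous phi ->
  P.-integrable setT (EFin \o (fun w => if Y w < tau then phi (Y w) else 0)) /\
  \int[P]_w (if Y w < tau then phi (Y w) else 0) =
  \int[mu]_(t in `[0, tau]) (phi t * (rate * expR (- rate * t))).
Proof.
move=> tau0 cphi.
have mphi : measurable_fun setT phi by exact: continuous_measurable_fun.
(* The added condition [0 <= t] bounds [f] on the whole line; it changes nothing at [Y w], which is
   nonnegative. *)
pose f t := if (0 <= t) && (t < tau) then phi t else 0.
have mf : measurable_fun setT f.
  apply: measurable_fun_ifT => //.
  by apply: measurable_and; [exact: measurable_fun_ler|exact: measurable_fun_ltr].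
have [M Mf] : exists M, forall t, `|f t| <= M.
  have : compact (phi @` `[0, tau]).
    apply: continuous_compact; last exact: segment_compact.
    exact: continuous_subspaceT.
  move=> /compact_bounded[M [Mr H]]; exists (`|M| + 1) => t.
  rewrite /f; case: ifPn => [/andP[t0 tt]|_]; last by rewrite normr0 addr_ge0.
  apply: (H (`|M| + 1)); first by rewrite (le_lt_trans (ler_norm M))// ltrDl.
  by exists t => //=; rewrite in_itv/= t0 ltW.
have fY w : (if Y w < tau then phi (Y w) else 0) = f (Y w).
  by rewrite /f Y0.
under eq_fun do rewrite fY.
have iY : P.-integrable setT (EFin \o (f \o Y)).
  apply: measurable_bounded_integrable => //.
  - by rewrite ltey_eq fin_num_measure.
  - exact: measurableT_comp.
  - by exists M; split; [exact: num_real|move=> x Mx w _; rewrite /= (le_trans (Mf _))// ltW].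
split => //; rewrite /Rintegral; congr fine.
pose Ym : {mfun T >-> measurableTypeR R} :=
  HB.pack Y (isMeasurableFun.Build _ _ T (measurableTypeR R) _ mY).
have mfE : measurable_fun (setT : set (measurableTypeR R)) (EFin \o f).
  exact/measurable_EFinP.
transitivity (\int[distribution P Ym]_t (f t)%:E)%E.
  by rewrite (@integral_law _ _ _ P _ _ Ym (EFin \o f)).
transitivity (\int[exponential_prob rate]_t (f t)%:E)%E.
  by apply: eq_measure_integral => A mA _; exact: exponential_lawE.
rewrite (integral_exponential_prob rate0); last first.
  apply: measurable_bounded_integrable => //.
  - by rewrite ltey_eq fin_num_measure.
  - by exists M; split; [exact: num_real|move=> x Mx w _; rewrite /= (le_trans (Mf _))// ltW].
transitivity (\int[mu]_(t in `[0%R, tau[) (phi t * (rate * expR (- rate * t)))%:E)%E.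
  rewrite [RHS]integral_mkcond; apply: eq_integral => t _.
  rewrite patchE /f; case: ifPn.
    move=> /andP[t0 tt]; rewrite ifT ?exponential_pdfE//.
    by rewrite inE/= in_itv/= t0.
  move=> H; rewrite mul0e ifF//; apply/negP; rewrite inE/= in_itv/=.
  by apply/negP.
rewrite integral_itv_bndo_bndc//.
apply/measurable_EFinP/measurable_funTS; apply: measurable_funM => //.
apply: measurable_funM => //; apply: measurableT_comp => //.
Qed.

Lemma exponential_resolvent (g g' : R -> R) (tau : R) : 0 <= tau ->
  (forall t : R, is_derive t (1 : R) g (g' t)) -> continuous g' ->
  P.-integrable setT (EFin \o (fun w => g (Num.min (Y w) tau))) /\
  \int[P]_w g (Num.min (Y w) tau) =
    g 0 + rate^-1 * \int[P]_w (if Y w < tau then g' (Y w) else 0).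
Proof.
move=> tau0 dg cg'.
have cg : continuous g.
  by move=> t; apply: differentiable_continuous; apply/derivable1_diffP.
have [ig Eg] := exponential_integral_itv tau0 cg.
have [ig' Eg'] := exponential_integral_itv tau0 cg'.
have c1 : continuous (fun _ : R => 1 : R) by move=> ?; exact: cvg_cst.
have [i1 E1] := exponential_integral_itv tau0 c1.
have gE w : g (Num.min (Y w) tau) = (if Y w < tau then g (Y w) else 0) +
    (g tau - g tau * (if Y w < tau then 1 else 0)).
  by rewrite minEle; case: ltP => h; rewrite ?h ?(ltW h)//=;
     [rewrite mulr1 subrr addr0|rewrite mulr0 subr0 add0r; case: leP => // h'; congr g; lra].
under eq_fun do rewrite gE.
(* Stated for any [h] because it serves twice: for [g], and for the constant 1, where it gives the
   probability of [Y < tau]. *)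
have FTC (h h' : R -> R) : (forall t : R, is_derive t (1 : R) h (h' t)) -> continuous h' ->
    \int[mu]_(t in `[0, tau]) (h t * (rate * expR (- rate * t))) =
    h 0 - h tau * expR (- rate * tau) +
    rate^-1 * \int[mu]_(t in `[0, tau]) (h' t * (rate * expR (- rate * t))).
  move=> dh ch'.
  have ch : continuous h.
    by move=> t; apply: differentiable_continuous; apply/derivable1_diffP.
  have ce : continuous (fun t : R => expR (- rate * t)).
    move=> t; apply: continuous_comp; last exact: continuous_expR.
    exact: mulrl_continuous.
  have cM (k : R -> R) : continuous k ->
      continuous (fun t => k t * (rate * expR (- rate * t))).
    move=> ck t; apply: cvgM; first exact: ck.
    by apply: cvgM; [exact: cvg_cst|exact: ce].
  have iM (k : R -> R) : continuous k ->
      mu.-integrable `[0, tau] (EFin \o (fun t => k t * (rate * expR (- rate * t)))).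
    move=> ck; apply: continuous_compact_integrable; first exact: segment_compact.
    by apply: continuous_subspaceT; exact: cM.
  have [t0|t0] := eqVneq tau 0.
    by rewrite t0 set_itv1 !Rintegral_set1 !mulr0 expR0 mulr1 addr0 subrr.
  have tau_gt0 : 0 < tau by rewrite lt_neqAle eq_sym t0.
  apply/eqP; rewrite -subr_eq; apply/eqP.
  rewrite -RintegralZl//; last exact: iM.
  rewrite -RintegralB//; [|exact: iM|]; last first.
    rewrite (_ : EFin \o _ = (fun x => (rate^-1)%:E *
        (h' x * (rate * expR (- rate * x)))%:E)%E) //.
    by apply: integrableZl => //; exact: iM.
  pose F t := - (h t * expR (- rate * t)).
  have dF (t : R) : is_derive t (1 : R) F
      (h t * (rate * expR (- rate * t)) - rate^-1 * (h' t * (rate * expR (- rate * t)))).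
    have de : is_derive t (1 : R) (fun t => expR (- rate * t)) (- rate * expR (- rate * t)).
      have dl : is_derive t (1 : R) (fun t : R => - rate * t) (- rate).
        have := @is_deriveZ R R R (@id R) (- rate) t 1 1 (is_derive_id t 1).
        by rewrite /GRing.scale/= mulr1.
      have := @is_derive1_comp R expR (fun t => - rate * t) t _ _ (is_derive_expR _) dl.
      by rewrite mulrC.
    apply: is_derive_eq.
    rewrite /GRing.scale/=; field; exact: lt0r_neq0.
  rewrite /Rintegral (@continuous_FTC2 _ _ F 0 tau tau_gt0).
  - by rewrite -EFinB /= /F mulr0 expR0; ring.
  - apply: continuous_subspaceT => t; apply: cvgB; first exact: cM.
    by apply: cvgM; [exact: cvg_cst|exact: cM].
  - have cF : continuous F.
      by move=> t; apply: differentiable_continuous; apply/derivable1_diffP.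
    split; [by move=> t _; exact: (@ex_derive _ _ _ _ _ _ _ (dF t))| |].
      by apply: cvg_at_right_filter; exact: cF.
    by apply: cvg_at_left_filter; exact: cF.
  - by move=> t _; rewrite derive1E; exact: derive_val.
pose q w : R := if Y w < tau then 1 else 0.
pose p w : R := if Y w < tau then g (Y w) else 0.
have ic : P.-integrable setT (EFin \o (fun w => g tau - g tau * (if Y w < tau then 1 else 0))).
  rewrite (_ : EFin \o _ = (EFin \o (fun _ : T => g tau)) \-
      (fun w => (g tau)%:E * (q w)%:E))%E //.
  apply: integrableB => //; last exact: integrableZl.
  exact: finite_measure_integrable_cst.
split.
  rewrite (_ : EFin \o _ = (EFin \o p) \+ (EFin \o (fun w => (g tau - g tau * q w)%R)))%E //.
  exact: integrableD.
rewrite RintegralD// RintegralB//; last 2 first.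
- exact: finite_measure_integrable_cst.
- rewrite (_ : EFin \o _ = (fun w => (g tau)%:E * (q w)%:E))%E //.
  exact: integrableZl.
rewrite RintegralZl// Eg E1 Eg' (FTC g g')//.
rewrite (FTC (fun=> 1) (fun=> 0))//; last by move=> ?; exact: cvg_cst.
rewrite Rintegral_cst//.
have -> : fine (P [set: T]) = 1 by rewrite (@probability_setT _ _ _ P).
have -> : \int[mu]_(t in `[0, tau]) (0 * (rate * expR (- rate * t))) = 0.
  rewrite (@eq_Rintegral _ _ _ mu _ (fun=> 0)); first by rewrite Rintegral_cst// mul0r.
  by move=> t _; rewrite mul0r.
ring.
Qed.

End exponential_rv.

(** * Derivatives of the Lyapunov functions along draining works *)

Section derivatives.
Context {R : realType}.
Lemma is_derive_half (k t : R) : is_derive t (1 : R) (fun t => k - t / 2) (- 2^-1).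
Proof.
apply: is_derive_eq.
rewrite /GRing.scale/=; field.
Unshelve. all: by [].
Qed.

(** The weight [q] lets one formula serve the cubic in the excess ([q] = 1) and the squares of the
    works ([q] = 0). *)
Lemma is_derive_cubic (k a b q t : R) : is_derive t (1 : R)
  (fun t => q * (k - t / 2) ^+ 3 + a * (k - t / 2) ^+ 2 + b * (k - t / 2))
  (- (3 * q / 2 * (k - t / 2) ^+ 2 + a * (k - t / 2) + b / 2)).
Proof.
have := is_derive_half k t => h.
apply: is_derive_eq.
rewrite /GRing.scale/=; field.
Unshelve. all: by [].
Qed.

Lemma is_derive_mul_half (x y t : R) : is_derive t (1 : R)
  (fun t => (x - t / 2) * (y - t / 2)) (- (((x - t / 2) + (y - t / 2)) / 2)).
Proof.
have := is_derive_half x t => h.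
have := is_derive_half y t => h'.
apply: is_derive_eq.
rewrite /GRing.scale/=; field.
Unshelve. all: by [].
Qed.

Lemma is_derive_Nmul_half (th x t : R) :
  is_derive t (1 : R) (fun t => - (th * (x - t / 2))) (th / 2).
Proof.
have h := is_derive_half x t.
apply: is_derive_eq; rewrite /GRing.scale/=; field.
Unshelve. all: by [].
Qed.

Lemma is_derive_exp_half (th x t : R) : is_derive t (1 : R)
  (fun t => expR (- (th * (x - t / 2)))) (th / 2 * expR (- (th * (x - t / 2)))).
Proof.
have h1 := is_derive_Nmul_half th x t.
have := @is_derive1_comp R expR (fun t => - (th * (x - t / 2))) t _ _ (is_derive_expR _) h1.
by rewrite mulrC.
Qed.

Lemma is_derive_mul_exp_half (th x y t : R) : is_derive t (1 : R)
  (fun t => (y - t / 2) * expR (- (th * (x - t / 2))))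
  ((th / 2 * (y - t / 2) - 2^-1) * expR (- (th * (x - t / 2)))).
Proof.
have h := is_derive_half y t.
have h1 := is_derive_exp_half th x t.
apply: is_derive_eq; rewrite /GRing.scale/=; field.
Unshelve. all: by [].
Qed.

Lemma continuous_derivable (f f' : R -> R) : (forall t : R, is_derive t (1 : R) f (f' t)) -> continuous f.
Proof.
by move=> df t; apply: differentiable_continuous; apply/derivable1_diffP.
Qed.
Lemma continuous_half (k : R) : continuous (fun t : R => k - t / 2).
Proof. exact: (continuous_derivable (is_derive_half k)). Qed.
End derivatives.

(** * Combining the drift inequalities *)

Section assembly.
Context {R : realType}.
Variables (al be eps de mp lam c L EW pl eta : R).
Hypotheses (al0 : 0 < al) (be0 : 0 < be) (eps0 : 0 < eps) (de0 : 0 < de)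
  (mp0 : 0 < mp) (al_half : al <= 2^-1) (be_half : be <= 2^-1)
  (albe : al + be <= 1) (de_eps : de <= eps) (de_be : 2 * de <= be)
  (L2 : 2 <= L) (cE : c = 2 * mp / be * L)
  (pl0 : 0 <= pl) (pl1 : pl <= 1) (etaE : eta = (2 * be * de / 3) ^+ 2).
(** Sums over the first N arrivals of the means of 1(x = 0), exp (- theta x),
  1(x > c), u^2, x, y, y 1(x = 0) and y 1(x > c). *)
Variables (Mz Me Ma U2 Mx My Yz Ya : nat -> R).
Hypotheses (Mz0 : forall N, 0 <= Mz N) (Me0 : forall N, 0 <= Me N)
  (Mx0 : forall N, 0 <= Mx N) (My0 : forall N, 0 <= My N).
Local Notation th := (be / mp).
Local Notation pi := (be / (al + be)).
Local Notation T1 := (be / (al ^+ 2 * (al + be))).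
Local Notation T2 := (Num.sqrt (be / (al ^+ 2 * eps * (al + be)))).
Local Notation T3 := (L / (be * (al + be))).

Hypothesis exp_bound : forall N,
  th / 2 * (be / 2 * Me N + Mz N - (1 + be / 2) * eta * N%:R) <= lam.
Hypothesis snd_zero1_bound : forall N,
  th / 2 * (Yz N - (1 + be / 2) * eta * My N) <= Me N.
Hypothesis above_bound : forall N, (al + be) * Ma N <= 2^-1 * Mz N + be * N%:R.
Hypothesis excess_bound : exists C, forall N,
  3 * al * U2 N - 5 / 8 * (mp ^+ 2 / al) * Ma N <= C.
Hypothesis total_bound : forall v, 0 < v -> exists C, forall N,
  eps * (Mx N + My N) - 2^-1 * Yz N - (8 * v)^-1 * U2 N -
    (eps * EW + (c + v) * eps) * N%:R <= C.
Hypothesis snd_above_bound : forall N, (al + be) * Ya N <=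
  be * My N + 2^-1 * Yz N + 2^-1 * Mx N + 2^-1 * mp * N%:R.
Hypothesis fst_bound : forall N,
  Mx N <= c * N%:R + 2^-1 * (al / mp * U2 N + mp / al * Ma N).

Let de_quarter : de <= 4^-1.
Proof. by move: be_half de_be; lra. Qed.

Let albe0 : 0 < al + be. Proof. exact: addr_gt0. Qed.

Let pi0 : 0 < pi. Proof. exact: divr_gt0. Qed.

Let pi1 : pi <= 1.
Proof. by rewrite ler_pdivrMr// mul1r lerDr ltW. Qed.

Let eta0 : 0 <= eta. Proof. by rewrite etaE sqr_ge0. Qed.

Let de2 : de ^+ 2 <= 16^-1.
Proof.
have d0 := de0; have dq := de_quarter.
have -> : 16^-1 = 4^-1 ^+ 2 :> R by field.
by apply: lerXn2r; rewrite ?nnegrE// ltW.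
Qed.

Let etaE2 : eta = 4 / 9 * (be ^+ 2 * de ^+ 2).
Proof. by rewrite etaE; field. Qed.

(** [exp_bound] controls two nonnegative sums at once: the one with [Me] is dropped here, and the
    one with [Mz] in [Me_bound]. The 5/4 bounds 1 + be / 2 for be at most 1/2. *)
Let Mz_bound : exists C, forall N, Mz N <= 5 / 4 * eta * N%:R + C.
Proof.
exists (2 * lam / th) => N.
have th0 : 0 < th by exact: divr_gt0.
have h : be / 2 * Me N + Mz N - (1 + be / 2) * eta * N%:R <= 2 * lam / th.
  rewrite ler_pdivlMr//; have := exp_bound N; move: th0; set q := be / mp => q0; lra.
have m : 0 <= be * Me N by rewrite mulr_ge0// ltW.
have n : 0 <= (2^-1 - be) * (eta * N%:R) by rewrite mulr_ge0 ?subr_ge0// mulr_ge0.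
lra.
Qed.

Let Me_bound : exists C, forall N, Me N <= 2 / be * (5 / 4 * eta) * N%:R + C.
Proof.
exists (2 / be * (2 * lam / th)) => N.
have th0 : 0 < th by exact: divr_gt0.
have h : be / 2 * Me N + Mz N - (1 + be / 2) * eta * N%:R <= 2 * lam / th.
  rewrite ler_pdivlMr//; have := exp_bound N; move: th0; set q := be / mp => q0; lra.
have n : 0 <= (2^-1 - be) * (eta * N%:R) by rewrite mulr_ge0 ?subr_ge0// mulr_ge0.
have h2 : be / 2 * Me N <= 5 / 4 * eta * N%:R + 2 * lam / th.
  by have := Mz0 N; lra.
have -> : Me N = 2 / be * (be / 2 * Me N) by field; rewrite ?lt0r_neq0.
rewrite -[2 / be * (5 / 4 * eta) * _]mulrA -mulrDr ler_wpM2l//.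
by rewrite divr_ge0// ltW.
Qed.

(** Two divisions, by theta and by be, cost mp / be^2; the factor be^2 in [eta] repays it, so that
    only mp * de^2 remains per arrival. *)
Let Yz_bound : exists C, forall N,
  Yz N <= 5 / 9 * (be ^+ 2 * de ^+ 2) * My N + 20 / 9 * (mp * de ^+ 2) * N%:R + C.
Proof.
have [C HC] := Me_bound; exists (2 / th * C) => N.
have th0 : 0 < th by exact: divr_gt0.
have h : Yz N - (1 + be / 2) * eta * My N <= 2 / th * Me N.
  rewrite [leRHS](_ : _ = Me N / (th / 2)); last by field; rewrite ?lt0r_neq0.
  by rewrite ler_pdivlMr ?divr_gt0// mulrC; exact: snd_zero1_bound.
have h2 : 2 / th * Me N <= 2 / th * (2 / be * (5 / 4 * eta) * N%:R + C).
  by rewrite ler_wpM2l// divr_ge0// ltW.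
have n : 0 <= (2^-1 - be) * (eta * My N) by rewrite mulr_ge0 ?subr_ge0// mulr_ge0.
have e : 2 / th * (2 / be * (5 / 4 * eta) * N%:R + C) =
    20 / 9 * (mp * de ^+ 2) * N%:R + 2 / th * C.
  by rewrite etaE2; field; rewrite ?lt0r_neq0.
rewrite e in h2; rewrite etaE2 in h n.
lra.
Qed.

(** The idleness term, 5/8 of [eta], is at most be / 100 because be is at most 1/2 and de^2 at most
    1/16; hence 101/100. *)
Let Ma_bound : exists C, forall N, Ma N <= 101 / 100 * pi * N%:R + C.
Proof.
have [C HC] := Mz_bound; exists (2^-1 * C / (al + be)) => N.
have h : (al + be) * Ma N <= 2^-1 * (5 / 4 * eta * N%:R + C) + be * N%:R.
  by have := above_bound N; have := HC N; lra.
have hb : 2^-1 * (5 / 4 * eta) <= be / 100.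
  rewrite etaE2; have b0 := be0.
  have k1 : 0 <= be * (be * (16^-1 - de ^+ 2)).
    by apply: mulr_ge0; [exact: ltW|apply: mulr_ge0; [exact: ltW|rewrite subr_ge0]].
  have k2 : 0 <= be * (2^-1 - be) by apply: mulr_ge0; [exact: ltW|rewrite subr_ge0].
  by lra.
have {}hb := ler_wpM2r (ler0n R N) hb.
rewrite [leRHS](_ : _ = (101 / 100 * be * N%:R + 2^-1 * C) / (al + be)); last first.
  by field; rewrite ?lt0r_neq0.
by rewrite ler_pdivlMr//; lra.
Qed.

(** The 1/4 is 3/4 divided by 3, since 5/8 times 101/100 is below 3/4. *)
Let U2_bound : exists C, forall N, U2 N <= 4^-1 * (mp ^+ 2 * pi / al ^+ 2) * N%:R + C.
Proof.
have [C HC] := Ma_bound; have [C' HC'] := excess_bound.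
exists ((5 / 8 * (mp ^+ 2 / al) * C + C') / (3 * al)) => N.
have k : 0 <= mp ^+ 2 / al by rewrite divr_ge0 ?sqr_ge0 ?ltW.
have h := ler_wpM2l k (HC N); have := HC' N => h'.
have j : 0 <= mp ^+ 2 / al * pi * N%:R.
  by apply: mulr_ge0 => //; apply: mulr_ge0 => //; exact: ltW.
rewrite [leRHS](_ : _ = (3 / 4 * (mp ^+ 2 / al * pi * N%:R) + 5 / 8 * (mp ^+ 2 / al) * C + C') / (3 * al)); last first.
  by field; rewrite ?lt0r_neq0.
rewrite ler_pdivlMr ?mulr_gt0//.
move: h h' j; set q := mp ^+ 2 / al; set p := be / (al + be) => h h' j.
lra.
Qed.

Let Mx_bound : exists C, forall N, Mx N <= (c + 2 / 3 * (mp * pi / al)) * N%:R + C.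
Proof.
have [C HC] := Ma_bound; have [C' HC'] := U2_bound.
exists (2^-1 * (al / mp * C' + mp / al * C)) => N.
have h1 : al / mp * U2 N <= al / mp * (4^-1 * (mp ^+ 2 * pi / al ^+ 2) * N%:R + C').
  by apply: ler_wpM2l => //; rewrite divr_ge0// ltW.
have h2 : mp / al * Ma N <= mp / al * (101 / 100 * pi * N%:R + C).
  by apply: ler_wpM2l => //; rewrite divr_ge0// ltW.
have e1 : al / mp * (4^-1 * (mp ^+ 2 * pi / al ^+ 2) * N%:R + C') =
    4^-1 * (mp * pi / al * N%:R) + al / mp * C' by field; rewrite ?lt0r_neq0.
have e2 : mp / al * (101 / 100 * pi * N%:R + C) = 101 / 100 * (mp * pi / al * N%:R) + mp / al * C.
  by field; rewrite ?lt0r_neq0.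
rewrite e1 in h1; rewrite e2 in h2.
have j : 0 <= mp * pi / al * N%:R.
  by apply: mulr_ge0 => //; rewrite divr_ge0 ?ltW//; apply: mulr_gt0.
have := fst_bound N; move: h1 h2 j; set q := mp * pi / al * N%:R => h1 h2 j h.
rewrite mulrDl -[2 / 3 * _ * _]mulrA -/q; lra.
Qed.

Let T2_gt0 : 0 < T2.
Proof. by rewrite sqrtr_gt0 divr_gt0// !mulr_gt0// exprn_gt0. Qed.

Let T2_sqr : T2 ^+ 2 * eps = pi / al ^+ 2.
Proof.
rewrite sqr_sqrtr; first by field; rewrite ?lt0r_neq0.
by rewrite ltW// divr_gt0// !mulr_gt0// exprn_gt0.
Qed.

Let My_bound0 : exists C, forall N,
  (eps - 5 / 18 * (be ^+ 2 * de ^+ 2)) * My N <=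
  eps * (EW + c + 3 / 8 * (mp * T2) + 10 / 9 * (mp * de ^+ 2 / eps)) * N%:R + C.
Proof.
(* This choice of [v] roughly balances its own cost eps * v against U2 / (8 v), and this balance
   produces the square root [T2]. The two costs are 1/4 and 1/8 of eps * mp * T2, together the
   3/8. *)
have v0 : 0 < mp * T2 / 4 by rewrite divr_gt0// mulr_gt0.
have [C HC] := U2_bound; have [C' HC'] := Yz_bound; have [C2 HC2] := total_bound v0.
have T0 := T2_gt0; have Tsq := T2_sqr; move: v0 HC2 T0 Tsq; set t := T2 => v0 HC2 T0 Tsq.
exists ((2 * (mp * t))^-1 * C + 2^-1 * C' + C2) => N.
have w : (8 * (mp * t / 4))^-1 = (2 * (mp * t))^-1 by field; rewrite ?lt0r_neq0.
have := HC2 N; rewrite w => h.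
have w0 : 0 <= (2 * (mp * t))^-1 by rewrite invr_ge0 !mulr_ge0 ?ltW.
have h1 := ler_wpM2l w0 (HC N).
have e1 : (2 * (mp * t))^-1 * (4^-1 * (mp ^+ 2 * pi / al ^+ 2) * N%:R + C) =
    eps * (8^-1 * (mp * t)) * N%:R + (2 * (mp * t))^-1 * C.
  have -> : mp ^+ 2 * pi / al ^+ 2 = mp ^+ 2 * (t ^+ 2 * eps).
    by rewrite Tsq; field; rewrite ?lt0r_neq0.
  by field; rewrite ?lt0r_neq0.
rewrite e1 in h1.
have e2 : eps * (EW + c + 3 / 8 * (mp * t) + 10 / 9 * (mp * de ^+ 2 / eps)) * N%:R =
  eps * EW * N%:R + eps * c * N%:R + 3 / 8 * (eps * (mp * t) * N%:R) + 10 / 9 * (mp * de ^+ 2) * N%:R.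
  by field; rewrite ?lt0r_neq0.
rewrite e2.
have ex : 0 <= eps * Mx N by rewrite mulr_ge0// ltW.
by have := HC' N; lra.
Qed.

(** The factor 1 + de / eps pays for the absorbed multiple of [My]: times (eps - 5/18 be^2 de^2) /
    eps it is still at least 1, because de <= eps makes (eps + de) * 5/18 be^2 de^2 at most eps *
    de. *)
Let My_bound : exists C, forall N,
  My N <= (1 + de / eps) * (EW + c + 3 / 8 * (mp * T2) + 10 / 9 * (mp * de ^+ 2 / eps)) * N%:R + C.
Proof.
have [C HC] := My_bound0.
have T0 := T2_gt0; move: HC T0; set t := T2 => HC T0.
set B := EW + c + _ + _ in HC *.
exists ((1 + de / eps) / eps * C) => N.
have r0 : 0 <= (1 + de / eps) / eps by rewrite divr_ge0 ?addr_ge0 ?divr_ge0 ?ltW.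
have h := ler_wpM2l r0 (HC N).
have e1 : (1 + de / eps) / eps * (eps * B * N%:R + C) =
  (1 + de / eps) * B * N%:R + (1 + de / eps) / eps * C by field; rewrite ?lt0r_neq0.
rewrite e1 in h; apply: le_trans h; rewrite mulrA ler_peMl//.
have -> : (1 + de / eps) / eps * (eps - 5 / 18 * (be ^+ 2 * de ^+ 2)) =
   1 + (de * eps - (eps + de) * (5 / 18 * (be ^+ 2 * de ^+ 2))) / eps ^+ 2.
  by field; rewrite ?lt0r_neq0.
rewrite lerDl; apply: mulr_ge0; last by rewrite invr_ge0 sqr_ge0.
have d0 := de0; have ep := eps0; have b0 := be0.
have k1 : be ^+ 2 <= 4^-1.
  have -> : 4^-1 = 2^-1 ^+ 2 :> R by field.
  by apply: lerXn2r; rewrite ?nnegrE// ltW.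
have k2 : be ^+ 2 * de ^+ 2 <= 4^-1 * de ^+ 2 by rewrite ler_wpM2r ?sqr_ge0.
have k3 : (eps + de) * (be ^+ 2 * de ^+ 2) <= (2 * eps) * (4^-1 * de ^+ 2).
  apply: ler_pM => //; [lra|by rewrite mulr_ge0 ?sqr_ge0|by have := de_eps; lra].
have k4 : eps * (de * de) <= eps * (de * 4^-1).
  by rewrite !ler_wpM2l// ltW.
have k5 : 0 <= eps * de by rewrite mulr_ge0// ltW.
lra.
Qed.

(** The part of [Yz] proportional to [My] contributes at most be * My. This doubles [pi], and with
    the factor 2 of the response time gives the 4 in front of be / (al + be). *)
Let Ya_bound : exists C, forall N, Ya N <= 2 * pi * My N +
  (10 / 9 * (mp * de ^+ 2) + 2^-1 * c + 3^-1 * (mp * pi / al) + 2^-1 * mp) / (al + be) * N%:R + C.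
Proof.
have [C HC] := Yz_bound; have [C' HC'] := Mx_bound.
exists ((2^-1 * C + 2^-1 * C') / (al + be)) => N.
have b0 := be0.
have k : 5 / 18 * (be ^+ 2 * de ^+ 2) <= be.
  have k1 : 0 <= be * (be * (16^-1 - de ^+ 2)).
    by apply: mulr_ge0; [exact: ltW|apply: mulr_ge0; [exact: ltW|rewrite subr_ge0]].
  have k2 : 0 <= be * (2^-1 - be) by apply: mulr_ge0; [exact: ltW|rewrite subr_ge0].
  by lra.
have {}k := ler_wpM2r (My0 N) k.
rewrite [leRHS](_ : _ = (2 * be * My N + (10 / 9 * (mp * de ^+ 2) + 2^-1 * c + 3^-1 * (mp * pi / al) + 2^-1 * mp) * N%:R + (2^-1 * C + 2^-1 * C')) / (al + be)); last first.
  by field; rewrite ?lt0r_neq0.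
rewrite ler_pdivlMr//.
have := HC N; have := HC' N; have := snd_above_bound N.
set q := mp * pi / al; lra.
Qed.

(** All errors are multiples of q = mp * Tm: 14/3 q from [Mx], 3 q from [Ya], and at most 30 q from
    [My], whose total weight 2 pl + 4 pi is at most 6. The constant 44 leaves some room. *)
Lemma assembly_bound : exists C, forall N,
  2 * Mx N + 2 * Ya N + 2 * pl * My N <=
  ((2 * pl + 4 * pi) * (1 + de / eps) * EW + 44 * mp * Num.max T1 (Num.max T2 T3)) * N%:R + C.
Proof.
have [C HC] := Mx_bound; have [C' HC'] := Ya_bound; have [C2 HC2] := My_bound.
pose Tm := Num.max T1 (Num.max T2 T3).
have t1 : T1 <= Tm by rewrite le_max lexx.
have t2 : T2 <= Tm by rewrite !le_max lexx !orbT.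
have t3 : T3 <= Tm by rewrite !le_max lexx !orbT.
have T0 : 0 <= Tm by apply: le_trans t2; rewrite sqrtr_ge0.
have b0 := be0; have ep := eps0; have m0 := mp0; have d0 := de0.
(* This lower bound makes mp / (al + be), and with it mp, at most a quarter of mp * Tm. *)
have Lbe : 4 <= L / be by rewrite ler_pdivlMr//; move: be_half L2; lra.
have T3E : T3 = L / be / (al + be) by field; rewrite ?lt0r_neq0.
have inv1 : 1 <= (al + be)^-1 by rewrite invf_ge1.
have inv0 : 0 <= (al + be)^-1 by rewrite invr_ge0 ltW.
have mpT : mp * T3 <= mp * Tm by rewrite ler_pM2l.
have mpT1 : mp * T1 <= mp * Tm by rewrite ler_pM2l.
have mpT2 : mp * T2 <= mp * Tm by rewrite ler_pM2l.
have f2 : mp / (al + be) <= mp * Tm / 4.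
  have : 0 <= mp * ((L / be - 4) / (al + be)).
    by rewrite mulr_ge0 ?(ltW m0)// mulr_ge0// subr_ge0.
  by move: mpT; rewrite T3E; lra.
have f6 : mp <= mp * Tm / 4.
  by apply: le_trans f2; rewrite ler_peMr// ltW.
have f5 : c / (al + be) <= 2 * (mp * Tm).
  by rewrite (_ : _ / _ = 2 * (mp * T3)) ?ler_pM2l// cE; field; rewrite ?lt0r_neq0.
have c0 : 0 <= c.
  by rewrite cE mulr_ge0 ?divr_ge0 ?mulr_ge0 ?ltW//; move: L2; lra.
have f1 : c <= 2 * (mp * Tm).
  by apply: le_trans f5; rewrite ler_peMr.
have f3 : mp * pi / al <= 2^-1 * (mp * Tm).
  have -> : mp * pi / al = al * (mp * T1) by field; rewrite ?lt0r_neq0.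
  by apply: ler_pM => //; rewrite ?(ltW al0)// mulr_ge0 ?divr_ge0 ?ltW// mulr_gt0// exprn_gt0.
have f4 : mp * pi / al / (al + be) <= mp * Tm.
  have -> : mp * pi / al / (al + be) = (al / (al + be)) * (mp * T1).
    by field; rewrite ?lt0r_neq0.
  rewrite -[leRHS]mul1r; apply: ler_pM => //.
  - by rewrite divr_ge0 ?ltW.
  - by rewrite mulr_ge0 ?divr_ge0 ?ltW// mulr_gt0// exprn_gt0.
  - by rewrite ler_pdivrMr// mul1r lerDl ltW.
have f7 : mp * de ^+ 2 <= mp / 16 by rewrite ler_pM2l.
have f8 : mp * de ^+ 2 / eps <= mp / 4.
  rewrite ler_pdivrMr// -mulrA ler_pM2l// expr2.
  by apply: (@le_trans _ _ (4^-1 * de)); [rewrite ler_pM2r|rewrite ler_pM2l].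
have f9 : mp * de ^+ 2 / (al + be) <= mp * Tm / 64.
  have h : mp * de ^+ 2 / (al + be) <= mp / 16 / (al + be) by rewrite ler_wpM2r.
  by lra.
pose s := 1 + de / eps.
have s1 : 1 <= s by rewrite lerDl divr_ge0 ?ltW.
have s2 : s <= 2 by rewrite -[2]/(1 + 1) lerD2l ler_pdivrMr// mul1r.
pose q := mp * Tm; have q0 : 0 <= q by rewrite mulr_ge0 ?(ltW m0).
have hMy N : My N <= (s * EW + 5 * q) * N%:R + C2.
  apply: (le_trans (HC2 N)); rewrite lerD2r ler_wpM2r// -/s.
  pose B := c + 3 / 8 * (mp * T2) + 10 / 9 * (mp * de ^+ 2 / eps).
  have hB : B <= 5 / 2 * q by rewrite /B /q; lra.
  have : s * B <= 2 * (5 / 2 * q).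
    apply: ler_pM => //; first lra.
    have B1 : 0 <= mp * T2 by rewrite mulr_ge0 ?sqrtr_ge0 ?(ltW m0).
    have B2 : 0 <= mp * de ^+ 2 / eps by apply: divr_ge0; [apply: mulr_ge0; [exact: ltW|exact: sqr_ge0]|exact: ltW].
    by rewrite /B; move: c0 B1 B2; lra.
  by rewrite /B => hsB; lra.
exists (2 * C + 2 * C' + (2 * pl + 4 * pi) * C2) => N.
have n0 : 0 <= N%:R :> R by [].
have k0 : 0 <= 2 * pl + 4 * pi by move: pl0 pi0; lra.
have g1 := ler_wpM2l k0 (hMy N).
have k6 : 0 <= (6 - (2 * pl + 4 * pi)) * (q * N%:R).
  by apply: mulr_ge0; [move: pl1 pi1; lra|apply: mulr_ge0].
have g2 : Mx N <= (2 * q + 3^-1 * q) * N%:R + C.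
  by apply: (le_trans (HC N)); rewrite lerD2r ler_wpM2r// /q; lra.
have g3 : Ya N <= 2 * pi * My N + (3 / 2 * q) * N%:R + C'.
  apply: (le_trans (HC' N)); rewrite lerD2r lerD2l ler_wpM2r//.
  rewrite (_ : _ / (al + be) = 10 / 9 * (mp * de ^+ 2 / (al + be)) + 2^-1 * (c / (al + be)) +
    3^-1 * (mp * pi / al / (al + be)) + 2^-1 * (mp / (al + be))); last first.
    by field; rewrite ?lt0r_neq0.
  by rewrite /q; lra.
have kq : 0 <= q * N%:R by rewrite mulr_ge0.
have -> : 44 * mp * Num.max T1 (Num.max T2 T3) = 44 * q by rewrite /q /Tm; ring.
rewrite -/s; move: g1 k6 g2 g3 kq; set p := be / (al + be); lra.
Qed.
End assembly.

(** * Drift inequalities for CARD *)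

Section tame.
Context {R : realType}.

(** With [i = 3] and [j = 2] this growth makes [f] integrable along the chain:
  W_s is bounded at each step (only sizes below m_+ enter it), while W_l has no
  more moments than S, that is, two. *)
Definition tame (i j : nat) (f : R * R -> R) : Prop :=
  measurable_fun setT f /\
  exists2 C, 0 <= C & forall p, 0 <= p.1 -> 0 <= p.2 ->
    `|f p| <= C * ((1 + p.1) ^+ i * (1 + p.2) ^+ j).

Lemma tameD i j f g : tame i j f -> tame i j g -> tame i j (fun p => f p + g p).
Proof.
move=> [mf [C C0 fC]] [mg [D D0 gD]]; split; first exact: measurable_funD.
exists (C + D); first exact: addr_ge0.
move=> p x0 y0; rewrite (le_trans (ler_normD _ _))// mulrDl.
by apply: lerD; [exact: fC|exact: gD].
Qed.

Lemma tameM i j i' j' f g : tame i j f -> tame i' j' g ->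
  tame (i + i') (j + j') (fun p => f p * g p).
Proof.
move=> [mf [C C0 fC]] [mg [D D0 gD]]; split; first exact: measurable_funM.
exists (C * D); first exact: mulr_ge0.
move=> p x0 y0; rewrite normrM !exprD.
apply: (le_trans (ler_pM _ _ (fC p x0 y0) (gD p x0 y0))) => //.
by rewrite le_eqVlt; apply/orP; left; apply/eqP; ring.
Qed.

Lemma tame_weak i j i' j' f : (i <= i')%N -> (j <= j')%N -> tame i j f -> tame i' j' f.
Proof.
move=> ii jj [mf [C C0 fC]]; split=> //; exists C => // p x0 y0.
apply: (le_trans (fC p x0 y0)); rewrite ler_wpM2l//.
apply: ler_pM; rewrite ?exprn_ge0 ?addr_ge0//.
- by apply: ler_weXn2l; rewrite ?lerDl.
- by apply: ler_weXn2l; rewrite ?lerDl.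
Qed.

Lemma tame_bounded (f : R * R -> R) M : measurable_fun setT f ->
  (forall p, 0 <= p.1 -> 0 <= p.2 -> `|f p| <= M) -> tame 0 0 f.
Proof.
move=> mf fM; split => //; exists `|M|; first exact: normr_ge0.
move=> p x0 y0; rewrite !expr0 !mulr1 (le_trans (fM p x0 y0))//; exact: ler_norm.
Qed.

Lemma tame_cst i j k : tame i j (fun=> k).
Proof.
by apply: (tame_weak (leq0n i) (leq0n j)); apply: (@tame_bounded _ `|k|).
Qed.

Lemma tameN i j f : tame i j f -> tame i j (fun p => - f p).
Proof.
move=> [mf [C C0 fC]]; split; first exact: measurable_funN.
by exists C => // p x0 y0; rewrite normrN; exact: fC.
Qed.

Lemma tameB i j f g : tame i j f -> tame i j g -> tame i j (fun p => f p - g p).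
Proof. by move=> tf tg; apply: tameD => //; exact: tameN. Qed.

Lemma tameZ i j k f : tame i j f -> tame i j (fun p => k * f p).
Proof. exact: (tameM (tame_cst 0 0 k)). Qed.

Lemma tame_fst : tame 1 0 (fun p => p.1).
Proof.
split; first exact: measurable_fst.
exists 1 => // p x0 y0; rewrite expr0 expr1 mulr1 mul1r ger0_norm// lerDr//.
Qed.

Lemma tame_snd : tame 0 1 (fun p => p.2).
Proof.
split; first exact: measurable_snd.
exists 1 => // p x0 y0; rewrite expr0 expr1 !mul1r ger0_norm// lerDr//.
Qed.

Lemma tame_bool (b : R * R -> bool) : measurable_fun setT b ->
  tame 0 0 (fun p => (b p)%:R).
Proof.
move=> mb; apply: (@tame_bounded _ 1).
  rewrite (_ : (fun p => _) = (fun p => if b p then 1 else 0)).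
    exact: measurable_fun_ifT.
  by apply/funext => p; case: (b p).
by move=> p _ _; case: (b p); rewrite ?normr1 ?normr0.
Qed.

Lemma tameX i j n f : tame i j f -> tame (i * n) (j * n) (fun p => f p ^+ n).
Proof.
move=> tf; elim: n => [|n IH]; first by rewrite !muln0; exact: tame_cst.
by under eq_fun do rewrite exprS; rewrite !mulnS; exact: tameM.
Qed.

Lemma tameDm i j i' j' f g : tame i j f -> tame i' j' g ->
  tame (maxn i i') (maxn j j') (fun p => f p + g p).
Proof.
move=> tf tg; apply: tameD.
  by apply: tame_weak tf; exact: leq_maxl.
by apply: tame_weak tg; exact: leq_maxr.
Qed.

Lemma tame_measurable i j f : tame i j f -> measurable_fun setT f.
Proof. by case. Qed.

(** Indicators are real-valued in order to enter products. Works are nonnegative along the chain, so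
    [<= 0] means that the server is idle. *)
Definition at_zero1 (p : R * R) : R := (p.1 <= 0)%R%:R.
Definition at_zero2 (p : R * R) : R := (p.2 <= 0)%R%:R.
Definition above (c : R) (p : R * R) : R := (c < p.1)%R%:R.
Definition excess (c : R) (p : R * R) : R := Num.max (p.1 - c) 0.

Lemma tame_at_zero1 : tame 0 0 at_zero1.
Proof. by apply: tame_bool; apply: measurable_fun_ler. Qed.

Lemma tame_at_zero2 : tame 0 0 at_zero2.
Proof. by apply: tame_bool; apply: measurable_fun_ler. Qed.

Lemma tame_above c : tame 0 0 (above c).
Proof. by apply: tame_bool; apply: measurable_fun_ltr. Qed.

Lemma tame_excess c : 0 <= c -> tame 1 0 (excess c).
Proof.
move=> c0; split.
  by apply: measurable_maxr => //; exact: measurable_funB.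
exists 1 => // p x0 y0; rewrite expr0 expr1 mulr1 mul1r /excess.
rewrite ger0_norm ?le_max ?lexx ?orbT// ge_max; apply/andP; split; lra.
Qed.

Lemma tame_expR th : 0 <= th -> tame 0 0 (fun p => expR (- (th * p.1))).
Proof.
move=> th0; apply: (@tame_bounded _ 1).
  apply: measurableT_comp => //; apply: measurable_funN; exact: measurable_funM.
move=> p x0 _; rewrite ger0_norm ?expR_ge0// -expR0 ler_expR oppr_le0.
exact: mulr_ge0.
Qed.

End tame.

(** Growth exponents are computed by recursion on the syntax. Unfolding comes last, so local
    definitions are opened only when no rule applies. *)
Ltac tame_infer :=
  lazymatch goal with
  | |- tame _ _ (fun p => @GRing.add _ (@?f p) (@?g p)) =>
      eapply (@tameDm _ _ _ _ _ f g); tame_infer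
  | |- tame _ _ (fun p => @GRing.opp _ (@?f p)) => eapply (@tameN _ _ _ f); tame_infer
  | |- tame _ _ (fun p => @GRing.mul _ (@?f p) (@?g p)) =>
      eapply (@tameM _ _ _ _ _ f g); tame_infer
  | |- tame _ _ (fun p => @GRing.exp _ (@?f p) ?n) => eapply (@tameX _ _ _ n f); tame_infer
  | |- tame _ _ (fun _ => ?k) => exact (tame_cst 0 0 k)
  | |- tame _ _ fst => exact tame_fst
  | |- tame _ _ snd => exact tame_snd
  | |- tame _ _ (fun p => fst p) => exact tame_fst
  | |- tame _ _ (fun p => snd p) => exact tame_snd
  | |- tame _ _ (@at_zero1 _) => exact tame_at_zero1
  | |- tame _ _ (fun p => at_zero1 p) => exact tame_at_zero1
  | |- tame _ _ (@at_zero2 _) => exact tame_at_zero2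
  | |- tame _ _ (fun p => at_zero2 p) => exact tame_at_zero2
  | |- tame _ _ (above ?c) => exact (tame_above c)
  | |- tame _ _ (fun p => above ?c p) => exact (tame_above c)
  | |- tame _ _ (excess ?c) => apply tame_excess; assumption
  | |- tame _ _ (fun p => excess ?c p) => apply tame_excess; assumption
  | |- tame _ _ (fun p => expR (- (?th * fst p))) => apply tame_expR; assumption
  | |- tame ?i ?j (fun p => ?f p) => change (tame i j f); tame_infer
  | |- tame _ _ ?f => progress unfold f; tame_infer
  end.
Ltac tame_tac := eapply tame_weak; [| |tame_infer]; by [].

(** * The chain of works seen at arrivals and its integrability *)

Section process.
Context {d} {T : measurableType d} {R : realType} (P : probability T R).
Variables (A S : nat -> T -> R) (lam mminus mplus c : R).
Hypotheses (mA : forall i, measurable_fun setT (A i))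
  (mS : forall i, measurable_fun setT (S i))
  (ind : mutually_independent P (input_family A S))
  (lam0 : 0 < lam)
  (tailA : forall i t, 0 <= t -> P [set w | t < A i w] = (expR (- (lam * t)))%:E)
  (idS : forall i B, measurable B -> P (S i @^-1` B) = P (S 0%N @^-1` B))
  (A_ge0 : forall i w, 0 <= A i w) (S_ge0 : forall i w, 0 <= S i w)
  (S2 : P.-integrable setT (EFin \o (fun w => S 0%N w ^+ 2)))
  (mplus0 : 0 <= mplus) (mminus_mplus : mminus <= mplus).

Local Notation X := (fun n w => card_state mminus mplus c (A ^~ w) (S ^~ w) n).
Local Notation J := (jump mminus mplus c).
Local Notation XJ := (fun n w => J (X n w) (S n w)).

Lemma card_to_short_lt x s : card_to_short mminus mplus c x s -> s < mplus.
Proof.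
by case/orP => [/lt_le_trans|/andP[/andP[]]//]; exact.
Qed.

Lemma drain_ge0 t w : 0 <= drain t w :> R.
Proof. by rewrite /drain le_max lexx orbT. Qed.

Lemma drain_le (t w : R) : 0 <= t -> 0 <= w -> drain t w <= w.
Proof. by move=> t0 w0; rewrite /drain ge_max w0 andbT lerBlDr lerDl divr_ge0. Qed.

Lemma state_ge0 n w : 0 <= (X n w).1 /\ 0 <= (X n w).2.
Proof. by case: n => [|n]; rewrite ?card_stateS //=; split; exact: drain_ge0. Qed.

Lemma jump_ge0 (p : R * R) s : 0 <= p.1 -> 0 <= p.2 -> 0 <= s ->
  0 <= (J p s).1 /\ 0 <= (J p s).2.
Proof. by move=> x0 y0 s0; rewrite /jump; case: ifP => /= _; rewrite ?addr_ge0. Qed.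

Lemma jump_le (p : R * R) s : 0 <= s ->
  (J p s).1 <= p.1 + mplus /\ (J p s).2 <= p.2 + s.
Proof.
move=> s0; rewrite /jump; case: ifPn => /= [/card_to_short_lt/ltW h|_].
  by rewrite lerD2l lerDl.
by rewrite lexx lerDl.
Qed.

Lemma state1_le n w : (X n w).1 <= n%:R * mplus.
Proof.
elim: n => [|n IH]; first by rewrite mul0r.
rewrite card_stateS /=; have [x0 y0] := state_ge0 n w.
have [xJ _] := jump_ge0 x0 y0 (S_ge0 n w).
apply: (le_trans (drain_le (A_ge0 n w) xJ)).
apply: (le_trans (jump_le _ (S_ge0 n w)).1).
by rewrite -natr1 mulrDl mul1r lerD2r.
Qed.

Lemma measurable_state n : measurable_fun setT (X n).
Proof. by apply: measurable_card_state. Qed.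

Lemma measurable_XJ n : measurable_fun setT (XJ n).
Proof.
exact: (measurableT_comp (measurable_jump mminus mplus c)
  (measurable_fun_pair (measurable_state n) (mS n))).
Qed.

Lemma integrable_sqrS n : P.-integrable setT (EFin \o (fun w => S n w ^+ 2)).
Proof.
apply/integrableP; split; first by apply/measurable_EFinP; exact: measurable_funX.
move/integrableP : S2 => [_]; congr (_ < _)%E; apply/esym.
apply: (integral_ident_distr (P := P) (f := fun s : R => `|(s ^+ 2)%:E|%E)) => //.
- by move=> B mB; exact: idS.
- by apply: measurableT_comp => //; apply/measurable_EFinP; exact: exprn_measurable.
Qed.

Lemma integrable_cstR (k : R) : P.-integrable setT (EFin \o (fun=> k)).
Proof. exact: finite_measure_integrable_cst. Qed.

Lemma integrable_leR (f g : T -> R) : measurable_fun setT f ->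
  (forall w, `|f w| <= g w) -> P.-integrable setT (EFin \o g) ->
  P.-integrable setT (EFin \o f).
Proof.
move=> mf fg ig; apply: (le_integrable measurableT _ _ ig).
  exact/measurable_EFinP.
by move=> w _ /=; rewrite lee_fin (le_trans (fg w))// ler_norm.
Qed.

Lemma integrableZR (k : R) (f : T -> R) : P.-integrable setT (EFin \o f) ->
  P.-integrable setT (EFin \o (fun w => k * f w)).
Proof.
move=> fi; rewrite (_ : EFin \o _ = (fun w => k%:E * (f w)%:E)%E) //.
exact: integrableZl.
Qed.

Lemma integrableDR (f g : T -> R) : P.-integrable setT (EFin \o f) ->
  P.-integrable setT (EFin \o g) -> P.-integrable setT (EFin \o (fun w => f w + g w)).
Proof.
move=> fi gi; rewrite (_ : EFin \o _ = ((EFin \o f) \+ (EFin \o g))%E) //.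
exact: integrableD.
Qed.

(** An arrival adds at most [S n] to the long server, and (1 + y + s)^2 <= 2 (1 + y)^2 + 2 s^2;
    draining only lowers the work. The finite second moment of the sizes enters here. *)
Lemma integrable_XJ2 n : 
  P.-integrable setT (EFin \o (fun w => (1 + (X n w).2) ^+ 2)) /\
  P.-integrable setT (EFin \o (fun w => (1 + (XJ n w).2) ^+ 2)).
Proof.
have m2 : measurable_fun setT (fun z : R * R => (1 + z.2) ^+ 2).
  by apply: measurable_funX; apply: measurable_funD.
have step k : P.-integrable setT (EFin \o (fun w => (1 + (X k w).2) ^+ 2)) ->
    P.-integrable setT (EFin \o (fun w => (1 + (XJ k w).2) ^+ 2)).
  move=> iX.
  apply: (integrable_leR (g := fun w => 2 * (1 + (X k w).2) ^+ 2 + 2 * S k w ^+ 2)).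
  - exact: (measurableT_comp m2 (measurable_XJ k)).
  - move=> w; rewrite ger0_norm ?sqr_ge0//.
    have [x0 y0] := state_ge0 k w.
    have [_ yJ] := jump_ge0 x0 y0 (S_ge0 k w).
    have [_ h] := jump_le (X k w) (S_ge0 k w).
    have := S_ge0 k w; set s := S k w in h *; set y := (X k w).2 in h y0 *.
    move=> s0; apply: (@le_trans _ _ ((1 + y + s) ^+ 2)).
      by apply: lerXn2r; rewrite ?nnegrE ?addr_ge0// -addrA lerD2l.
    rewrite -subr_ge0 (_ : _ - _ = (1 + y - s) ^+ 2); first exact: sqr_ge0.
    by ring.
  - by apply: integrableDR; apply: integrableZR => //; exact: integrable_sqrS.
suff : P.-integrable setT (EFin \o (fun w => (1 + (X n w).2) ^+ 2)).
  by move=> h; split => //; exact: step.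
elim: n => [|n /step IH].
  exact: (integrable_cstR ((1 + 0) ^+ 2)).
apply: (integrable_leR _ _ IH).
  exact: (measurableT_comp m2 (measurable_state n.+1)).
move=> w; rewrite ger0_norm ?sqr_ge0//.
have [_ y0'] := state_ge0 n.+1 w.
have [x0 y0] := state_ge0 n w.
have [_ yJ] := jump_ge0 x0 y0 (S_ge0 n w).
apply: lerXn2r; rewrite ?nnegrE ?addr_ge0// lerD2l card_stateS.
exact: drain_le.
Qed.

Lemma integrable_tame_state n f : tame 3 2 f ->
  P.-integrable setT (EFin \o (fun w => f (X n w))).
Proof.
move=> [mf [C C0 fC]].
apply: (integrable_leR (g := fun w => C * (1 + n%:R * mplus) ^+ 3 * (1 + (X n w).2) ^+ 2)).
- exact: (measurableT_comp mf (measurable_state n)).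
- move=> w; have [x0 y0] := state_ge0 n w.
  apply: (le_trans (fC _ x0 y0)); rewrite -mulrA ler_wpM2l// ler_wpM2r ?sqr_ge0//.
  have := state1_le n w => h.
  by apply: lerXn2r; rewrite ?nnegrE ?addr_ge0 ?mulr_ge0// lerD2l.
- by apply: integrableZR; exact: (integrable_XJ2 n).1.
Qed.

Lemma integrable_tame_XJ n f : tame 3 2 f ->
  P.-integrable setT (EFin \o (fun w => f (XJ n w))).
Proof.
move=> [mf [C C0 fC]].
apply: (integrable_leR (g := fun w => C * (1 + n.+1%:R * mplus) ^+ 3 * (1 + (XJ n w).2) ^+ 2)).
- exact: (measurableT_comp mf (measurable_XJ n)).
- move=> w; have [x0 y0] := state_ge0 n w.
  have [xJ yJ] := jump_ge0 x0 y0 (S_ge0 n w).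
  apply: (le_trans (fC _ xJ yJ)); rewrite -mulrA ler_wpM2l// ler_wpM2r ?sqr_ge0//.
  have [h _] := jump_le (X n w) (S_ge0 n w).
  have := state1_le n w => h'.
  apply: lerXn2r; rewrite ?nnegrE ?addr_ge0 ?mulr_ge0// lerD2l.
  by rewrite -natr1 mulrDl mul1r; lra.
- by apply: integrableZR; exact: (integrable_XJ2 n).2.
Qed.

Lemma integrable_tame_jump p f : 0 <= p.1 -> 0 <= p.2 -> tame 3 2 f ->
  P.-integrable setT (EFin \o (fun w => f (J p (S 0%N w)))).
Proof.
move=> x0 y0 [mf [C C0 fC]].
apply: (integrable_leR (g := fun w => C * (1 + p.1 + mplus) ^+ 3 *
  (2 * (1 + p.2) ^+ 2 + 2 * S 0%N w ^+ 2))).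
- apply: (measurableT_comp mf).
  exact: (measurableT_comp (measurable_jump mminus mplus c)
    (measurable_fun_pair (measurable_cst p) (mS 0%N))).
- move=> w; have s0 := S_ge0 0%N w.
  have [xJ yJ] := jump_ge0 x0 y0 s0.
  have [hx hy] := jump_le p s0.
  apply: (le_trans (fC _ xJ yJ)); rewrite -mulrA ler_wpM2l//.
  apply: ler_pM; rewrite ?exprn_ge0 ?addr_ge0//.
    by apply: lerXn2r; rewrite ?nnegrE ?addr_ge0// -addrA lerD2l.
  apply: (@le_trans _ _ ((1 + p.2 + S 0%N w) ^+ 2)).
    by apply: lerXn2r; rewrite ?nnegrE ?addr_ge0// -addrA lerD2l.
  rewrite -subr_ge0 (_ : _ - _ = (1 + p.2 - S 0%N w) ^+ 2); first exact: sqr_ge0.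
  by ring.
- apply: integrableZR; apply: integrableDR; last exact: integrableZR.
  exact: integrable_cstR.
Qed.

Lemma integrable_tame_drain p f : 0 <= p.1 -> 0 <= p.2 -> tame 3 2 f ->
  P.-integrable setT (EFin \o (fun w => f (drain_state (A 0%N w) p))).
Proof.
move=> x0 y0 [mf [C C0 fC]].
apply: (integrable_leR (g := fun w => C * ((1 + p.1) ^+ 3 * (1 + p.2) ^+ 2))).
- apply: (measurableT_comp mf).
  exact: (measurableT_comp measurable_drain_state
    (measurable_fun_pair (measurable_cst p) (mA 0%N))).
- move=> w; have a0 := A_ge0 0%N w.
  apply: (le_trans (fC (drain_state (A 0%N w) p) (drain_ge0 _ _) (drain_ge0 _ _))); rewrite ler_wpM2l//.
  have hx := drain_le a0 x0; have hy := drain_le a0 y0.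
  have hx0 := drain_ge0 (A 0%N w) p.1; have hy0 := drain_ge0 (A 0%N w) p.2.
  apply: ler_pM; rewrite ?exprn_ge0 ?addr_ge0//;
    by apply: lerXn2r; rewrite ?nnegrE ?addr_ge0// lerD2l.
- exact: integrable_cstR.
Qed.


(** * Independence of the next input from the past *)

Let mAS i : measurable_fun setT (input_family A S i).
Proof. by case: i. Qed.

Let idx k k' : seq (nat + nat) := map inl (iota 0 k) ++ map inr (iota 0 k').

Let idx_uniq k k' : uniq (idx k k').
Proof.
rewrite cat_uniq !map_inj_uniq ?iota_uniq//=; try by move=> ? ? [].
by rewrite andbT; apply/hasPn => _ /mapP[i _ ->]; apply/negP => /mapP[j _].
Qed.

Let mem_inl k k' i : (inl i \in idx k k') = (i < k)%N.
Proof.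
rewrite mem_cat mem_map; last by move=> ? ? [].
rewrite mem_iota add0n /= [X in _ || X](_ : _ = false) ?orbF//.
by apply/negP => /mapP[].
Qed.

Let mem_inr k k' i : (inr i \in idx k k') = (i < k')%N.
Proof.
rewrite mem_cat orbC mem_map; last by move=> ? ? [].
rewrite mem_iota add0n /= [X in _ || X](_ : _ = false) ?orbF//.
by apply/negP => /mapP[].
Qed.

Let measurable_A_cyl k k' i : (i < k)%N -> measurable_fun
  (setT : set (g_sigma_algebraType (cylinder (input_family A S) (idx k k')))) (A i).
Proof.
move=> ik; apply: (@measurable_cylinder_coord _ _ _ _ (input_family A S) _ (inl i)).
  exact: idx_uniq.
by rewrite mem_inl.
Qed.

Let measurable_S_cyl k k' i : (i < k')%N -> measurable_fun
  (setT : set (g_sigma_algebraType (cylinder (input_family A S) (idx k k')))) (S i).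
Proof.
move=> ik; apply: (@measurable_cylinder_coord _ _ _ _ (input_family A S) _ (inr i)).
  exact: idx_uniq.
by rewrite mem_inr.
Qed.

Let indep_state_S n : indep_pair P (X n) (S n).
Proof.
apply: (indep_pair_cylinder mAS ind (L := idx n n) (j := inr n)).
- exact: idx_uniq.
- by rewrite mem_inr ltnn.
- by apply: measurable_card_state => i ni; [exact: measurable_A_cyl|exact: measurable_S_cyl].
Qed.

(** Just after arrival [n] the state has used n + 1 sizes but only n interarrival times, hence the
    list [idx n n.+1]. *)
Let indep_XJ_A n : indep_pair P (XJ n) (A n).
Proof.
apply: (indep_pair_cylinder mAS ind (L := idx n n.+1) (j := inl n)).
- exact: idx_uniq.
- by rewrite mem_inl ltnn.
- have mX := @measurable_card_state _ mminus mplus c _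
    (g_sigma_algebraType (cylinder (input_family A S) (idx n n.+1))) A S n.
  have {}mX := mX (fun i ni => @measurable_A_cyl n n.+1 i ni)
    (fun i ni => @measurable_S_cyl n n.+1 i (ltnW ni)).
  have mSn := @measurable_S_cyl n n.+1 n (ltnSn n).
  exact: (measurableT_comp (measurable_jump mminus mplus c) (measurable_fun_pair mX mSn)).
Qed.

Lemma EFin_Rintegral (f : T -> R) : P.-integrable setT (EFin \o f) ->
  (\int[P]_w (f w)%:E = (\int[P]_w f w)%:E)%E.
Proof. by move=> fi; rewrite fineK//; exact: integrable_fin_num. Qed.

Lemma jump_step n (f psi : R * R -> R) : tame 3 2 f -> tame 3 2 psi ->
  (forall p, 0 <= p.1 -> 0 <= p.2 -> \int[P]_w f (J p (S 0%N w)) <= psi p) ->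
  \int[P]_w f (XJ n w) <= \int[P]_w psi (X n w).
Proof.
move=> tf tpsi H.
have mf := tame_measurable tf.
apply: (indep_integral_le (phi := fun z => f (J z.1 z.2))) => //.
- exact: measurable_state.
- exact: (measurableT_comp mf (measurable_jump mminus mplus c)).
- exact: integrable_tame_XJ.
- exact: integrable_tame_state.
move=> w /=; have [x0 y0] := state_ge0 n w.
rewrite (integral_ident_distr (Y' := S 0%N) (f := fun s => (f (J (X n w) s))%:E))//.
- rewrite EFin_Rintegral ?lee_fin; first exact: H.
  exact: integrable_tame_jump.
- by move=> B mB; exact: idS.
- apply/measurable_EFinP; apply: (measurableT_comp mf).
  exact: (measurableT_comp (measurable_jump mminus mplus c) (pair1_measurable _)).
Qed.

Lemma drain_step n (phi f : R * R -> R) : tame 3 2 phi -> tame 3 2 f ->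
  (forall p, 0 <= p.1 -> 0 <= p.2 ->
    \int[P]_w phi (drain_state (A 0%N w) p) <= f p) ->
  \int[P]_w phi (X n.+1 w) <= \int[P]_w f (XJ n w).
Proof.
move=> tphi tf H.
have mphi := tame_measurable tphi.
under eq_Rintegral do rewrite card_stateS.
apply: (indep_integral_le (phi := fun z => phi (drain_state z.2 z.1)) (X := XJ n)) => //.
- exact: measurable_XJ.
- exact: (measurableT_comp mphi measurable_drain_state).
- have := integrable_tame_state n.+1 tphi.
  by under eq_fun do rewrite card_stateS.
- exact: integrable_tame_XJ.
move=> w /=; have [x0 y0] := state_ge0 n w.
have [xJ yJ] := jump_ge0 x0 y0 (S_ge0 n w).
rewrite (integral_ident_distr (Y' := A 0%N) (f := fun t => (phi (drain_state t (XJ n w)))%:E))//.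
- rewrite EFin_Rintegral ?lee_fin; first exact: H.
  exact: integrable_tame_drain.
- move=> B mB; rewrite (exponential_lawE lam0 (mA n) (tailA n))//.
  by rewrite (exponential_lawE lam0 (mA 0%N) (tailA 0%N)).
- apply/measurable_EFinP; apply: (measurableT_comp mphi).
  exact: (measurableT_comp measurable_drain_state (pair1_measurable _)).
Qed.

(** * Sums of means over arrivals and telescoping *)

Definition cumulative_mean (N : nat) (f : R * R -> R) : R :=
  \sum_(k < N) \int[P]_w f (X k w).
Local Notation M := cumulative_mean.

Lemma cumulative_meanD N f g : tame 3 2 f -> tame 3 2 g ->
  M N (fun p => f p + g p) = M N f + M N g.
Proof.
move=> tf tg; rewrite /M -big_split/=; apply: eq_bigr => k _.
by rewrite RintegralD//; exact: integrable_tame_state.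
Qed.

Lemma cumulative_meanZ N k f : tame 3 2 f -> M N (fun p => k * f p) = k * M N f.
Proof.
move=> tf; rewrite /M mulr_sumr; apply: eq_bigr => i _.
by rewrite RintegralZl//; exact: integrable_tame_state.
Qed.

Lemma cumulative_mean_cst N k : M N (fun=> k) = N%:R * k.
Proof.
rewrite /M (eq_bigr (fun=> k)).
  by rewrite sumr_const card_ord mulr_natl.
move=> i _; rewrite Rintegral_cst//.
have -> : fine (P [set: T]) = 1 by rewrite (@probability_setT _ _ _ P).
by rewrite mulr1.
Qed.

Lemma le_cumulative_mean N f g : tame 3 2 f -> tame 3 2 g ->
  (forall p, 0 <= p.1 -> 0 <= p.2 -> f p <= g p) -> M N f <= M N g.
Proof.
move=> tf tg fg; apply: ler_sum => k _; apply: le_Rintegral => //.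
- exact: integrable_tame_state.
- exact: integrable_tame_state.
- by move=> w _; apply: fg; [exact: (state_ge0 k w).1|exact: (state_ge0 k w).2].
Qed.

(** In applications [phi = f + h / lam] with [- h] the drift of [f] while work
  drains, and [psi = f + k / lam] with [k] its drift through arrivals, so that
  [lam * (phi - psi) = h - k] is minus the total drift. *)
Lemma drift_telescope N (phi f psi D : R * R -> R) (C : R) :
  tame 3 2 phi -> tame 3 2 f -> tame 3 2 psi -> tame 3 2 D ->
  (forall p, 0 <= p.1 -> 0 <= p.2 ->
    \int[P]_w phi (drain_state (A 0%N w) p) <= f p) ->
  (forall p, 0 <= p.1 -> 0 <= p.2 -> \int[P]_w f (J p (S 0%N w)) <= psi p) ->
  (forall p, 0 <= p.1 -> 0 <= p.2 -> - C <= phi p) ->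
  (forall p, 0 <= p.1 -> 0 <= p.2 -> D p <= lam * (phi p - psi p)) ->
  M N D <= lam * (phi (0, 0) + C).
Proof.
move=> tphi tf tpsi tD Hd Hj HC HD.
apply: (@le_trans _ _ (M N (fun p => lam * (phi p - psi p)))).
  by apply: le_cumulative_mean => //; apply: tameZ; exact: tameB.
rewrite cumulative_meanZ; last exact: tameB.
rewrite ler_pM2l//.
have tNpsi := tameN tpsi.
rewrite cumulative_meanD//.
under [X in _ + X]eq_bigr do under eq_Rintegral do rewrite -mulN1r.
rewrite -/(M N (fun p => -1 * psi p)) cumulative_meanZ// mulN1r.
(* The mean of [phi] at the next arrival is at most that of [f] after the jump, hence at most that
   of [psi] before it. Only the last mean of [phi] is left over, and a lower bound on it
   suffices. *)
have tele : M N phi + \int[P]_w phi (X N w) <= M N psi + phi (0, 0).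
  elim: N => [|n IH].
    rewrite /M !big_ord0 !add0r /= Rintegral_cst//.
    have -> : fine (P [set: T]) = 1 by rewrite (@probability_setT _ _ _ P).
    by rewrite mulr1.
  rewrite /M !big_ord_recr /= -/(M n phi) -/(M n psi).
  have h1 := drain_step n tphi tf Hd.
  have h2 := jump_step n tf tpsi Hj.
  have h := le_trans h1 h2; lra.
have : - C <= \int[P]_w phi (X N w).
  have -> : - C = \int[P]_w (- C).
    rewrite Rintegral_cst//.
    have -> : fine (P [set: T]) = 1 by rewrite (@probability_setT _ _ _ P).
    by rewrite mulr1.
  apply: le_Rintegral => //.
  - exact: integrable_cstR.
  - exact: integrable_tame_state.
  - by move=> w _; apply: HC; [exact: (state_ge0 N w).1|exact: (state_ge0 N w).2].
lra.
Qed.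


(** * Mean effect of one jump and of one drain *)

Local Notation S0 := (S 0%N).
Local Notation A0 := (A 0%N).

(** The rate at which work enters the short server while its work is [x]. The drift estimates use
    the routing only through this rate and the bound [mplus] on the jumps of the short server. *)
Definition short_load (x : R) : R :=
  lam * \int[P]_w (if card_to_short mminus mplus c x (S0 w) then S0 w else 0).
Local Notation ES := (\int[P]_w S0 w).
Local Notation ES2 := (\int[P]_w (S0 w ^+ 2)).
Local Notation rho := (lam * ES).

Lemma integrable_size : P.-integrable setT (EFin \o S0).
Proof.
apply: (integrable_leR (g := fun w => 1 + S0 w ^+ 2)) => //.
  move=> w; have s0 := S_ge0 0%N w; rewrite ger0_norm//.
  have := sqr_ge0 (S0 w - 2^-1); have -> : (S0 w - 2^-1) ^+ 2 = S0 w ^+ 2 - S0 w + 4^-1 by field.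
  lra.
by apply: integrableDR => //; exact: integrable_cstR.
Qed.

Lemma integrable_size_if (b : R -> bool) : measurable_fun setT b ->
  P.-integrable setT (EFin \o (fun w => if b (S0 w) then S0 w else 0)).
Proof.
move=> mb; apply: (integrable_leR _ _ integrable_size).
  by apply: measurable_fun_ifT => //; exact: (measurableT_comp mb (mS 0%N)).
by move=> w; case: ifP => _; rewrite ?normr0 ?ger0_norm ?S_ge0.
Qed.

Lemma measurable_short x : measurable_fun setT (card_to_short mminus mplus c x).
Proof.
exact: (measurableT_comp (measurable_card_to_short mminus mplus c) (pair1_measurable x)).
Qed.

(** The increments of the Lyapunov functions are at most linear in the size, with a slope that
    depends on the destination, plus a quadratic term; their means therefore involve only
    [short_load], [rho] and the second moment. *)
Lemma jump_bound (f : R * R -> R) (p : R * R) (k0 k1 k2 k3 : R) : tame 3 2 f ->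
  0 <= p.1 -> 0 <= p.2 ->
  (forall s, 0 <= s -> f (J p s) <=
     k0 + (if card_to_short mminus mplus c p.1 s then k1 else k2) * s + k3 * s ^+ 2) ->
  \int[P]_w f (J p (S0 w)) <=
    k0 + lam^-1 * (k1 * short_load p.1 + k2 * (rho - short_load p.1)) + k3 * ES2.
Proof.
move=> tf x0 y0 H.
pose B w : R := if card_to_short mminus mplus c p.1 (S0 w) then S0 w else 0.
have iB : P.-integrable setT (EFin \o B).
  by apply: integrable_size_if; exact: measurable_short.
have iS := integrable_size.
apply: (@le_trans _ _ (\int[P]_w (k0 + ((k1 - k2) * B w + (k2 * S0 w + k3 * S0 w ^+ 2))))).
  apply: le_Rintegral => //.
  - exact: integrable_tame_jump.
  - apply: integrableDR; first exact: integrable_cstR.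
    apply: integrableDR; first exact: integrableZR.
    by apply: integrableDR; apply: integrableZR.
  - move=> w _; apply: (le_trans (H _ (S_ge0 0%N w))).
    by rewrite /B; case: ifP => _; rewrite le_eqVlt; apply/orP; left; apply/eqP; ring.
have i1 : P.-integrable setT (EFin \o (fun w => (k1 - k2) * B w)) by exact: integrableZR.
have i2 : P.-integrable setT (EFin \o (fun w => k2 * S0 w)) by exact: integrableZR.
have i3 : P.-integrable setT (EFin \o (fun w => k3 * S0 w ^+ 2)) by exact: integrableZR.
have i23 := integrableDR i2 i3; have i123 := integrableDR i1 i23.
rewrite RintegralD//; last exact: integrable_cstR.
rewrite (RintegralD measurableT i1 i23) (RintegralD measurableT i2 i3).
rewrite !RintegralZl// Rintegral_cst//.
have -> : fine (P [set: T]) = 1 by rewrite (@probability_setT _ _ _ P).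
rewrite /short_load.
rewrite le_eqVlt; apply/orP; left; apply/eqP.
rewrite -[\int[P]_w (if _ then _ else _)]/(\int[P]_w B w).
by field; exact: lt0r_neq0.
Qed.

(** Works drain linearly until a hitting time [tau] and then [g] freezes; at an
  exponential time this expression has mean [g 0] ([resolvent_mean]). *)
Definition resolvent (g g' : R -> R) (tau t : R) : R :=
  g (Num.min t tau) - lam^-1 * (if t < tau then g' t else 0).

Lemma resolvent_mean (g g' : R -> R) (tau : R) : 0 <= tau ->
  (forall t : R, is_derive t (1 : R) g (g' t)) -> continuous g' ->
  P.-integrable setT (EFin \o (fun w => resolvent g g' tau (A0 w))) /\
  \int[P]_w resolvent g g' tau (A0 w) = g 0.
Proof.
move=> tau0 dg cg'.
have [i1 E1] := exponential_resolvent lam0 (mA 0%N) (A_ge0 0%N) (tailA 0%N) tau0 dg cg'.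
have [i2 _] := exponential_integral_itv lam0 (mA 0%N) (A_ge0 0%N) (tailA 0%N) tau0 cg'.
have i3 := integrableZR (- lam^-1) i2.
have -> : (fun w => resolvent g g' tau (A0 w)) =
    (fun w => g (Num.min (A0 w) tau) + - lam^-1 * (if A0 w < tau then g' (A0 w) else 0)).
  by apply/funext => w; rewrite /resolvent mulNr.
split; first exact: integrableDR.
by rewrite RintegralD// E1 RintegralZl//; ring.
Qed.

(** An inequality is asked for rather than an equality because one server may go on draining after
    the other has emptied at [tau], when [g] is already frozen. *)
Lemma drain_bound (phi : R * R -> R) (p : R * R) (g g' : R -> R) (tau : R) :
  tame 3 2 phi -> 0 <= p.1 -> 0 <= p.2 -> 0 <= tau ->
  (forall t : R, is_derive t (1 : R) g (g' t)) -> continuous g' ->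
  (forall t, 0 <= t -> phi (drain_state t p) <= resolvent g g' tau t) ->
  \int[P]_w phi (drain_state (A0 w) p) <= g 0.
Proof.
move=> tphi x0 y0 tau0 dg cg' H.
have [i1 <-] := resolvent_mean tau0 dg cg'.
apply: le_Rintegral => //; first exact: integrable_tame_drain.
by move=> w _; apply: H; exact: A_ge0.
Qed.

(** * Work and idleness of the short server *)

Hypothesis c0 : 0 <= c.
Variables (al be eps : R).
Hypotheses (al0 : 0 < al) (be0 : 0 < be) (eps0 : 0 < eps) (mp0 : 0 < mplus).
Hypothesis short_loadE : forall x, short_load x = 2^-1 + be - (al + be) * above c (x, 0).
Hypothesis rhoE : rho = 1 - eps.

Lemma mean_one : fine (P [set: T]) = 1.
Proof. by rewrite (@probability_setT _ _ _ P). Qed.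

Lemma short_load_ge0 x : 0 <= short_load x.
Proof.
apply: mulr_ge0; first exact: ltW.
by apply: Rintegral_ge0 => w _; case: ifP.
Qed.

Lemma short_load_le_rho x : short_load x <= rho.
Proof.
rewrite ler_pM2l//; apply: le_Rintegral => //.
- by apply: integrable_size_if; exact: measurable_short.
- exact: integrable_size.
- by move=> w _; case: ifP.
Qed.

Lemma short_load_le x : short_load x <= lam * mplus.
Proof.
rewrite ler_pM2l//; apply: (@le_trans _ _ (\int[P]_w mplus)).
  apply: le_Rintegral => //.
  - by apply: integrable_size_if; exact: measurable_short.
  - exact: integrable_cstR.
  - by move=> w _; case: ifP => // /card_to_short_lt/ltW.
by rewrite Rintegral_cst// mean_one mulr1.
Qed.

Lemma al_le : al <= 2^-1.
Proof.
have := short_load_ge0 (c + 1); rewrite short_loadE /above/= ltrDl ltr01 mulr1n; lra.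
Qed.

Lemma be_le : be <= 2^-1.
Proof.
have := short_load_le_rho 0; rewrite short_loadE rhoE /above/= ltNge c0 mulr0n mulr0 subr0; move: eps0; lra.
Qed.

Lemma be_lam : 2^-1 + be <= lam * mplus.
Proof.
have := short_load_le 0; rewrite short_loadE /above/= ltNge c0 mulr0n mulr0 subr0; lra.
Qed.

Local Notation th := (be / mplus).

Let th0 : 0 < th. Proof. exact: divr_gt0. Qed.
Let th_ge0 : 0 <= th. Proof. exact: ltW. Qed.

(** Keeps the factor 1 - th / (2 lam) in the Lyapunov functions built on exp (- th x) nonnegative,
    so that they are bounded below by 0. *)
Lemma th_lam : th / 2 <= lam.
Proof.
rewrite -mulrA [_^-1 * _]mulrC mulrA ler_pdivrMr//.
have := be_lam; have := be0; lra.
Qed.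

Lemma drainE_lt (t w : R) : t < 2 * w -> drain t w = w - t / 2.
Proof. by move=> tw; rewrite /drain max_l//; lra. Qed.

Lemma drainE_ge (t w : R) : 2 * w <= t -> drain t w = 0.
Proof. by move=> tw; rewrite /drain max_r//; lra. Qed.

(** As (1 + t / 2)^2 <= exp t, it suffices that the right side times (1 + t / 2)^2 is at least 1;
    the coefficient 3/4 is the one that cancels the t^2 term of this product. *)
Lemma expRN_le (t : R) : 0 <= t -> expR (- t) <= 1 - t + 3 / 4 * t ^+ 2.
Proof.
move=> t0; have h := expR_ge1Dx (t / 2).
have h2 : (1 + t / 2) ^+ 2 <= expR t.
  have -> : expR t = expR (t / 2) ^+ 2 by rewrite -expRM_natl; congr expR; field.
  by apply: lerXn2r; rewrite ?nnegrE ?expR_ge0 ?addr_ge0 ?divr_ge0.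
rewrite expRN -div1r ler_pdivrMr ?expR_gt0//.
have q0 : 0 <= 1 - t + 3 / 4 * t ^+ 2.
  have -> : 1 - t + 3 / 4 * t ^+ 2 = 3 / 4 * (t - 2 / 3) ^+ 2 + 2 / 3 by field.
  have := sqr_ge0 (t - 2 / 3); lra.
apply: le_trans (ler_wpM2l q0 h2).
have -> : (1 - t + 3 / 4 * t ^+ 2) * (1 + t / 2) ^+ 2 = 1 + (t ^+ 3 / 2 + 3 / 16 * t ^+ 4) by field.
have := exprn_ge0 3 t0; have := exprn_ge0 4 t0; rewrite lerDl; lra.
Qed.

Let e (p : R * R) : R := expR (- (th * p.1)).

(** A jump below [mplus] has th * s <= be, so the quadratic term of [expRN_le] is at most 3/4 be
    times the linear one. *)
Let decay_jump (p : R * R) s : 0 <= p.1 -> 0 <= s -> s < mplus ->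
  expR (- (th * (p.1 + s))) <= e p * (1 - th * (1 - 3 / 4 * be) * s).
Proof.
move=> x0 s0 smp.
rewrite mulrDr opprD expRD ler_wpM2l ?expR_ge0//.
have t0 : 0 <= th * s by apply: mulr_ge0.
apply: (le_trans (expRN_le t0)).
have tb : th * s <= be.
  by rewrite mulrAC ler_pdivrMr// ler_pM2l// ltW.
have := ler_wpM2l t0 tb; set q := th * s => h.
have -> : th * (1 - 3 / 4 * be) * s = q * (1 - 3 / 4 * be) by rewrite /q; ring.
by rewrite expr2; lra.
Qed.

Let short_load_cases x : (c < x /\ short_load x = 2^-1 - al) \/
  (x <= c /\ short_load x = 2^-1 + be).
Proof.
rewrite short_loadE /above/=; case: ltP => h; [left|right]; split=> //.
- by rewrite mulr1n mulr1 opprD addrACA subrr addr0.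
- by rewrite mulr0n mulr0 subr0.
Qed.

Lemma resolvent_lt (g g' : R -> R) tau t : t < tau ->
  resolvent g g' tau t = g t - lam^-1 * g' t.
Proof. by move=> h; rewrite /resolvent h min_l// ltW. Qed.

Lemma resolvent_ge (g g' : R -> R) tau t : tau <= t -> resolvent g g' tau t = g tau.
Proof. by move=> h; rewrite /resolvent ltNge h/= mulr0 subr0 min_r. Qed.

(** Below [c] the decay rate of [e] is th times (1 - 3/4 be)(1/2 + be) - 1/2, which is at least be /
    4 for be <= 1/2. An idle short server does not drain, which gives a further th / 2. Above [c]
    the growth is at most th / 2 * e with e <= exp (- th c); together with the be / 4 this gives the
    coefficient 1 + be / 2. *)
Lemma mean_exp_bound N :
  th / 2 * (be / 2 * M N e + M N at_zero1 - (1 + be / 2) * expR (- (th * c)) * N%:R)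
  <= lam.
Proof.
pose phi p := e p * (1 + - (th / (2 * lam)) * (1 + - at_zero1 p)).
pose psi p := e p + lam^-1 * (e p * (- (th * (1 - 3 / 4 * be))) *
  (2^-1 + be + - ((al + be) * above c p))).
pose D p := th / 2 * (be / 2) * e p + (th / 2 * at_zero1 p +
  - (th / 2 * ((1 + be / 2) * expR (- (th * c))))).
have te : tame 3 2 e by tame_tac.
have tz : tame 3 2 (@at_zero1 R) by tame_tac.
have -> : th / 2 * (be / 2 * M N e + M N at_zero1 - (1 + be / 2) * expR (- (th * c)) * N%:R) = M N D.
  rewrite /D cumulative_meanD; [|tame_tac..].
  rewrite cumulative_meanD; [|tame_tac..].
  by rewrite !cumulative_meanZ// cumulative_mean_cst; ring.
have thl : th / (2 * lam) <= 1.
  by rewrite ler_pdivrMr ?mulr_gt0// mul1r; have := th_lam; lra.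
have -> : lam = lam * (phi (0, 0) + 0).
  by rewrite /phi /e /at_zero1 /= lexx mulr1n mulr0 oppr0 expR0; ring.
have h1 : tame 3 2 phi by tame_tac.
have h2 : tame 3 2 psi by tame_tac.
have h3 : tame 3 2 D by tame_tac.
apply: (@drift_telescope N phi e psi D 0) => //.
- move=> [x y] /= x0 y0.
  have -> : e (x, y) = expR (- (th * (x - 0 / 2))) by rewrite mul0r subr0.
  (* At rate 1/2 the short server empties at time [2 * x]. *)
  apply: (@drain_bound phi (x, y) (fun t => expR (- (th * (x - t / 2))))
    (fun t => th / 2 * expR (- (th * (x - t / 2)))) (2 * x)) => //.
  + exact: mulr_ge0.
  + by move=> t; exact: is_derive_exp_half.
  + move=> t; apply: cvgM; first exact: cvg_cst.
    exact: (continuous_derivable (is_derive_exp_half th x)).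
  + move=> t t0; have [tx|xt] := ltP t (2 * x).
      rewrite resolvent_lt// /phi /e /at_zero1 /= drainE_lt//.
      have -> : (x - t / 2 <= 0) = false by apply/negbTE; rewrite -ltNge; lra.
      rewrite mulr0n oppr0 addr0 le_eqVlt; apply/orP; left; apply/eqP.
      by field; rewrite ?lt0r_neq0.
    rewrite resolvent_ge// /phi /e /at_zero1 /= drainE_ge// lexx.
    rewrite mulr1n subrr !mulr0 addr0 mulr1 (_ : x - 2 * x / 2 = 0) ?mulr0//.
    by field.
- move=> [x y] x0 y0.
  apply: (le_trans (@jump_bound e (x, y) (e (x, y))
    (- (th * (1 - 3 / 4 * be)) * e (x, y)) 0 0 _ _ _ _)) => //.
    move=> s s0; rewrite mul0r addr0 /jump.
    case: ifPn => [hs|_]; last by rewrite mul0r addr0.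
    have := decay_jump x0 s0 (card_to_short_lt hs); rewrite /e /= => h.
    by apply: (le_trans h); rewrite le_eqVlt; apply/orP; left; apply/eqP; ring.
  rewrite short_loadE /psi mul0r mul0r !addr0 /above /=.
  by rewrite le_eqVlt; apply/orP; left; apply/eqP; ring.
- move=> p x0 y0; rewrite oppr0 /phi mulr_ge0 ?expR_ge0// /at_zero1.
  have := divr_gt0 th0 (mulr_gt0 (@ltr0n R 2) lam0).
  by case: (p.1 <= 0); rewrite ?mulr1n ?mulr0n; move: thl; lra.
- move=> [x y] x0 y0.
  have -> : lam * (phi (x, y) - psi (x, y)) = e (x, y) * (th * (1 - 3 / 4 * be) * short_load x
      - th / 2 * (1 - at_zero1 (x, y))).
    by rewrite short_loadE /phi /psi /above /=; field; rewrite ?lt0r_neq0.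
  rewrite /D.
  have e0 : 0 <= e (x, y) by exact: expR_ge0.
  have ez : e (x, y) * at_zero1 (x, y) = at_zero1 (x, y).
    rewrite /e /at_zero1 /=; case: leP => h; last by rewrite mulr0.
    by rewrite (_ : x = 0) ?mulr0 ?oppr0 ?expR0 ?mul1r//; apply/eqP; rewrite eq_le h x0.
  have eta0 : 0 <= expR (- (th * c)) by exact: expR_ge0.
  have bh := be_le.
  have [[cx ->]|[cx ->]] := short_load_cases x.
    have ele : e (x, y) <= expR (- (th * c)).
      by rewrite /e /= ler_expR lerN2 ler_wpM2l// ltW.
    have -> : at_zero1 (x, y) = 0.
      by rewrite /at_zero1 /= leNgt (le_lt_trans c0 cx) mulr0n.
    have a1 : 0 <= th * ((1 - 3 / 4 * be) * (2^-1 - al) * e (x, y)).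
      have ah := al_le.
      apply: mulr_ge0 => //; apply: mulr_ge0 => //; apply: mulr_ge0; lra.
    have a2 : 0 <= th * ((1 + be / 2) * (expR (- (th * c)) - e (x, y))).
      apply: mulr_ge0 => //; apply: mulr_ge0; last by rewrite subr_ge0.
      by have := be0; lra.
    by lra.
  have a1 : 0 <= th * (e (x, y) * (be * (2^-1 - be))).
    apply: mulr_ge0 => //; apply: mulr_ge0 => //; apply: mulr_ge0; first exact: ltW.
    by rewrite subr_ge0.
  have a2 : 0 <= th * ((1 + be / 2) * expR (- (th * c))).
    apply: mulr_ge0 => //; apply: mulr_ge0 => //; have := be0; lra.
  have a3 : th * (e (x, y) * at_zero1 (x, y)) = th * at_zero1 (x, y) by rewrite ez.
  by lra.
Qed.

Local Notation eta := (expR (- (th * c))).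

(** The decay of exp (- th x) is multiplied by [y]; the jobs sent to the long server add [e] at a
    rate below 1, which gives the right side. The function vanishes at the empty state, so no
    constant is left. *)
Lemma mean_snd_zero1_bound N :
  th / 2 * (M N (fun p => p.2 * at_zero1 p) - (1 + be / 2) * eta * M N snd) <= M N e.
Proof.
pose f (p : R * R) := p.2 * e p.
(* The draining of [y] is left out of [phi]: it only lowers y exp (- th x), which is the favourable
   direction. *)
pose phi p := f p * (1 + - (th / (2 * lam)) * (1 + - at_zero1 p)).
pose psi p := f p + lam^-1 * (f p * (- (th * (1 - 3 / 4 * be))) *
  (2^-1 + be + - ((al + be) * above c p)) +
  e p * (rho + - (2^-1 + be + - ((al + be) * above c p)))).
pose yz (p : R * R) := p.2 * at_zero1 p.
pose D p := th / 2 * yz p + (- (th / 2 * ((1 + be / 2) * eta)) * p.2 + -1 * e p).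
have te : tame 3 2 e by tame_tac.
have tf : tame 3 2 f by tame_tac.
have ty : tame 3 2 (@snd R R) by tame_tac.
have tyz : tame 3 2 yz by tame_tac.
have h1 : tame 3 2 phi by tame_tac.
have h2 : tame 3 2 psi by tame_tac.
have h3 : tame 3 2 D by tame_tac.
suff : M N D <= 0.
  rewrite /D cumulative_meanD; [|tame_tac..].
  rewrite cumulative_meanD; [|tame_tac..].
  rewrite !cumulative_meanZ// -/yz; lra.
have thl : th / (2 * lam) <= 1.
  by rewrite ler_pdivrMr ?mulr_gt0// mul1r; have := th_lam; lra.
have thl0 : 0 < th / (2 * lam) by rewrite divr_gt0// mulr_gt0.
have -> : 0 = lam * (phi (0, 0) + 0) :> R by rewrite /phi /f /= !mul0r addr0 mulr0.
apply: (@drift_telescope N phi f psi D 0) => //.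
- move=> [x y] /= x0 y0.
  have -> : f (x, y) = (y - 0 / 2) * expR (- (th * (x - 0 / 2))) by rewrite mul0r !subr0.
  apply: (@drain_bound phi (x, y) (fun t => (y - t / 2) * expR (- (th * (x - t / 2))))
    (fun t => (th / 2 * (y - t / 2) - 2^-1) * expR (- (th * (x - t / 2))))
    (Num.min (2 * x) (2 * y))) => //.
  + by rewrite le_min !mulr_ge0.
  + by move=> t; exact: is_derive_mul_exp_half.
  + move=> t; apply: cvgM; last exact: (continuous_derivable (is_derive_exp_half th x)).
    apply: cvgB; last exact: cvg_cst.
    by apply: cvgM; [exact: cvg_cst|exact: continuous_half].
  + move=> t t0; have [tx|xt] := ltP t (Num.min (2 * x) (2 * y)).
      rewrite resolvent_lt//; move: tx; rewrite lt_min => /andP[tx ty'].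
      rewrite /phi /f /e /at_zero1 /= !drainE_lt//.
      have -> : (x - t / 2 <= 0) = false by apply/negbTE; rewrite -ltNge; lra.
      rewrite mulr0n oppr0 addr0.
      set E := expR _; have E0 : 0 <= lam^-1 * E by rewrite mulr_ge0 ?expR_ge0// invr_ge0 ltW.
      have -> : th / (2 * lam) = lam^-1 * (th / 2) by field; rewrite ?lt0r_neq0.
      by lra.
    rewrite resolvent_ge// /phi /f /e /at_zero1 /=.
    have [xy|yx] := leP x y.
      have m : Num.min (2 * x) (2 * y) = 2 * x by rewrite min_l// ler_pM2l.
      rewrite m in xt *.
      rewrite (drainE_ge xt) lexx mulr1n subrr !mulr0 oppr0 expR0 addr0 !mulr1.
      have -> : x - 2 * x / 2 = 0 by field.
      rewrite mulr0 oppr0 expR0 mulr1 /drain ge_max; apply/andP; split; lra.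
    have m : Num.min (2 * x) (2 * y) = 2 * y by rewrite min_r// ler_pM2l// ltW.
    rewrite m in xt *.
    rewrite (drainE_ge xt) !mul0r.
    have -> : y - 2 * y / 2 = 0 by field.
    by rewrite mul0r.
- move=> [x y] x0 y0.
  apply: (le_trans (@jump_bound f (x, y) (f (x, y))
    (- (th * (1 - 3 / 4 * be)) * f (x, y)) (e (x, y)) 0 _ _ _ _)) => //.
    move=> s s0; rewrite mul0r addr0 /jump.
    case: ifPn => [hs|_]; last by rewrite /f /e /= le_eqVlt; apply/orP; left; apply/eqP; ring.
    have := decay_jump x0 s0 (card_to_short_lt hs); rewrite /f /e /= => h.
    by apply: (le_trans (ler_wpM2l (y0 : 0 <= y) h)); rewrite le_eqVlt; apply/orP; left; apply/eqP; ring.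
  rewrite short_loadE /psi mul0r !addr0 /above /=.
  by rewrite le_eqVlt; apply/orP; left; apply/eqP; ring.
- move=> p x0 y0; rewrite oppr0 /phi /f mulr_ge0 ?mulr_ge0 ?expR_ge0// /at_zero1.
  by case: (p.1 <= 0); rewrite ?mulr1n ?mulr0n; move: thl thl0; lra.
- move=> [x y] x0 y0.
  have -> : lam * (phi (x, y) - psi (x, y)) = f (x, y) * (th * (1 - 3 / 4 * be) * short_load x
      - th / 2 * (1 - at_zero1 (x, y))) - e (x, y) * (rho - short_load x).
    by rewrite short_loadE /phi /psi /above /=; field; rewrite ?lt0r_neq0.
  rewrite /D /yz.
  have e0 : 0 <= e (x, y) by exact: expR_ge0.
  have ez : e (x, y) * at_zero1 (x, y) = at_zero1 (x, y).
    rewrite /e /at_zero1 /=; case: leP => h; last by rewrite mulr0.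
    by rewrite (_ : x = 0) ?mulr0 ?oppr0 ?expR0 ?mul1r//; apply/eqP; rewrite eq_le h x0.
  have eta0 : 0 <= eta by exact: expR_ge0.
  have bh := be_le.
  have g0 : 0 <= e (x, y) * (1 - (rho - short_load x)).
    apply: mulr_ge0 => //; have := short_load_ge0 x; rewrite rhoE; have := eps0; lra.
  have y0' : 0 <= y by [].
  have [[cx E]|[cx E]] := short_load_cases x.
    rewrite -/(f _) in g0 *; rewrite {1}E.
    have ele : e (x, y) <= eta.
      by rewrite /e /= ler_expR lerN2 ler_wpM2l// ltW.
    have -> : at_zero1 (x, y) = 0.
      by rewrite /at_zero1 /= leNgt (le_lt_trans c0 cx) mulr0n.
    have a1 : 0 <= y * (th * ((1 - 3 / 4 * be) * (2^-1 - al) * e (x, y))).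
      have ah := al_le.
      apply: mulr_ge0 => //; apply: mulr_ge0 => //; apply: mulr_ge0 => //; apply: mulr_ge0; lra.
    have a2 : 0 <= y * (th * ((1 + be / 2) * (eta - e (x, y)))).
      apply: mulr_ge0 => //; apply: mulr_ge0 => //; apply: mulr_ge0; last by rewrite subr_ge0.
      by have := be0; lra.
    have a3 : 0 <= y * (th * (be * e (x, y))).
      by apply: mulr_ge0 => //; apply: mulr_ge0 => //; apply: mulr_ge0 => //; exact: ltW.
    by rewrite /f /=; lra.
  rewrite {1}E.
  have a1 : 0 <= y * (th * (e (x, y) * (be * (2^-1 - be)))).
    apply: mulr_ge0 => //; apply: mulr_ge0 => //; apply: mulr_ge0 => //; apply: mulr_ge0; first exact: ltW.
    by rewrite subr_ge0.
  have a2 : 0 <= y * (th * ((1 + be / 2) * eta)).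
    apply: mulr_ge0 => //; apply: mulr_ge0 => //; apply: mulr_ge0 => //; have := be0; lra.
  have a3 : y * (th * (e (x, y) * at_zero1 (x, y))) = y * (th * at_zero1 (x, y)) by rewrite ez.
  have a4 : 0 <= y * (th * (be * e (x, y))).
    by apply: mulr_ge0 => //; apply: mulr_ge0 => //; apply: mulr_ge0 => //; exact: ltW.
  by rewrite /f /=; lra.
Qed.

(** Work balance of the short server: it gains at rate be below [c], loses at rate al above, and
    gains a further 1/2 while idle since nothing drains. As x is nonnegative and starts at 0, no
    constant is left. *)
Lemma mean_above_bound N :
  (al + be) * M N (above c) <= 2^-1 * M N at_zero1 + be * N%:R.
Proof.
pose f (p : R * R) := p.1.
pose phi (p : R * R) := p.1 + lam^-1 * (2^-1 * (1 + - at_zero1 p)).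
pose psi (p : R * R) := p.1 + lam^-1 * (2^-1 + be + - ((al + be) * above c p)).
pose D p := (al + be) * above c p + (- 2^-1 * at_zero1 p + - be).
have tz : tame 3 2 (@at_zero1 R) by tame_tac.
have ta : tame 3 2 (above c) by tame_tac.
have tf : tame 3 2 f by tame_tac.
have h1 : tame 3 2 phi by tame_tac.
have h2 : tame 3 2 psi by tame_tac.
have h3 : tame 3 2 D by tame_tac.
suff : M N D <= 0.
  rewrite /D cumulative_meanD; [|tame_tac..].
  rewrite cumulative_meanD; [|tame_tac..].
  rewrite !cumulative_meanZ// cumulative_mean_cst; lra.
have -> : 0 = lam * (phi (0, 0) + 0) :> R.
  by rewrite /phi /at_zero1 /= lexx mulr1n subrr !mulr0 !addr0 mulr0.
apply: (@drift_telescope N phi f psi D 0) => //.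
- move=> [x y] x0 y0.
  have -> : f (x, y) = x - 0 / 2 by rewrite mul0r subr0.
  apply: (@drain_bound phi (x, y) (fun t => x - t / 2) (fun t => - 2^-1) (2 * x)) => //.
  + exact: mulr_ge0.
  + by move=> t; exact: is_derive_half.
  + by move=> t; exact: cvg_cst.
  + move=> t t0; have [tx|xt] := ltP t (2 * x).
      rewrite resolvent_lt// /phi /at_zero1 /= !drainE_lt//.
      have -> : (x - t / 2 <= 0) = false by apply/negbTE; rewrite -ltNge; lra.
      by rewrite mulr0n; lra.
    rewrite resolvent_ge// /phi /at_zero1 /= !drainE_ge// lexx mulr1n; lra.
- move=> [x y] x0 y0.
  apply: (le_trans (@jump_bound f (x, y) x 1 0 0 _ _ _ _)) => //.
    move=> s s0; rewrite mul0r addr0 /jump /f.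
    by case: ifPn => [hs|_] /=; rewrite ?mul1r ?mul0r ?addr0.
  rewrite short_loadE /psi !mul0r !addr0 mul1r /above /=.
  by [].
- move=> p x0 y0; rewrite oppr0 /phi addr_ge0//.
  apply: mulr_ge0; first by rewrite invr_ge0 ltW.
  rewrite /at_zero1; apply: mulr_ge0; rewrite ?invr_ge0//; case: (p.1 <= 0); rewrite ?mulr1n ?mulr0n; lra.
- move=> [x y] x0 y0; rewrite /D /phi /psi /=.
  rewrite le_eqVlt; apply/orP; left; apply/eqP.
  by field; rewrite ?lt0r_neq0.
Qed.

Let excess_cases (p : R * R) : (c < p.1 /\ excess c p = p.1 - c /\ above c p = 1) \/
  (p.1 <= c /\ excess c p = 0 /\ above c p = 0).
Proof.
rewrite /excess /above; case: ltP => h; [left|right]; (split; first by []).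
  by rewrite max_l ?subr_ge0 ?ltW// mulr1n.
by rewrite max_r ?subr_le0// mulr0n.
Qed.

Let excess_drain (p : R * R) t : 0 <= t -> 0 <= p.1 ->
  (t < 2 * excess c p -> excess c (drain_state t p) = excess c p - t / 2 /\
     above c (drain_state t p) = 1) /\
  (2 * excess c p <= t -> excess c (drain_state t p) = 0 /\
     above c (drain_state t p) = 0).
Proof.
move=> t0 x0; have [cx|[cx [-> _]]] := excess_cases p.
  case: cx => cx [-> _]; have cc := c0; split => h.
    rewrite /excess /above /drain_state /= drainE_lt; last lra.
    by rewrite max_l; [split; [lra|rewrite (_ : c < _)//; lra]|lra].
  rewrite /excess /above /drain_state /=.
  have dc : drain t p.1 <= c by rewrite /drain ge_max c0 andbT; lra.
  by rewrite max_r ?subr_le0// ltNge dc.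
have cc := c0; split => h; first by lra.
rewrite /excess /above /drain_state /=.
have dc : drain t p.1 <= c by rewrite /drain ge_max c0 andbT; lra.
by rewrite max_r ?subr_le0// ltNge dc.
Qed.

(** Lyapunov function u^3 + a u^2 - b u: the coefficient b is large enough to
  make the jumps across the level c contribute nonpositively, so the overshoot
  of a crossing never has to be estimated. *)
Lemma mean_excess_bound : exists C, forall N,
  3 * al * M N (fun p => excess c p ^+ 2) - 5 / 8 * (mplus ^+ 2 / al) * M N (above c) <= C.
Proof.
(* Chosen so that 2 al a = 3/2 mplus, which cancels the negative term - 3/2 mplus u left by the
   cubic in the drift above [c]. Then b / 2 is at most 5/8 mplus^2 / al because al <= 1/2. *)
pose a := 3 / 4 * (mplus / al).
(* The value at which u^3 + a u^2 - b u vanishes for u = mplus; it is then nonpositive on the whole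
   range of overshoots from 0 to mplus. *)
pose b := mplus ^+ 2 + a * mplus.
have ah := al_le; have a0 : 0 < a by rewrite mulr_gt0// divr_gt0.
have mp := mp0.
have b0 : 0 < b by apply: addr_gt0; [exact: exprn_gt0|exact: mulr_gt0].
pose u := @excess R c.
pose f p := u p ^+ 3 + a * u p ^+ 2 + - b * u p.
pose phi p := f p + lam^-1 * (3 / 2 * u p ^+ 2 + a * u p + - (b / 2) * above c p).
(* For jumps that start above [c], the slope of the chord of [f] at the largest size [mplus] bounds
   that of every smaller jump. For jumps that start below, slope 0 suffices. *)
pose k1 p := above c p * (3 * u p ^+ 2 + 3 * mplus * u p + mplus ^+ 2 + 2 * a * u p + a * mplus + - b).
pose psi p := f p + lam^-1 * (k1 p * (2^-1 + be + - ((al + be) * above c p))).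
pose D p := 3 * al * u p ^+ 2 + - (5 / 8 * (mplus ^+ 2 / al)) * above c p.
(* Here a u^2 - b u is at least - b^2 / (4 a), and the last term of [phi] is at least - b / (2
   lam). *)
pose C := b ^+ 2 / (4 * a) + lam^-1 * (b / 2).
have tu2 : tame 3 2 (fun p => u p ^+ 2) by tame_tac.
have ta : tame 3 2 (above c) by tame_tac.
have tf : tame 3 2 f by tame_tac.
have h1 : tame 3 2 phi by tame_tac.
have h2 : tame 3 2 psi by tame_tac.
have h3 : tame 3 2 D by tame_tac.
exists (lam * (phi (0, 0) + C)) => N.
suff : M N D <= lam * (phi (0, 0) + C).
  rewrite /D cumulative_meanD; [|tame_tac..].
  by rewrite !cumulative_meanZ// mulNr.
have u0 p : 0 <= u p by rewrite /u /excess le_max lexx orbT.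
apply: (@drift_telescope N phi f psi D C) => //.
- move=> p x0 y0.
  have -> : f p = 1 * (u p - 0 / 2) ^+ 3 + a * (u p - 0 / 2) ^+ 2 + - b * (u p - 0 / 2).
    by rewrite mul0r subr0 mul1r.
  apply: (@drain_bound phi p
    (fun t => 1 * (u p - t / 2) ^+ 3 + a * (u p - t / 2) ^+ 2 + - b * (u p - t / 2))
    (fun t => - (3 * 1 / 2 * (u p - t / 2) ^+ 2 + a * (u p - t / 2) + - b / 2)) (2 * u p)) => //.
  + exact: mulr_ge0.
  + by move=> t; exact: is_derive_cubic.
  + have ch := @continuous_half R (u p).
    move=> t; apply: cvgN; apply: cvgD; last exact: cvg_cst.
    apply: cvgD; last by apply: cvgM; [exact: cvg_cst|exact: ch].
    apply: cvgM; first exact: cvg_cst.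
    exact: (continuous_comp (ch t) (@exprn_continuous R 2 _)).
  + move=> t t0; have [dl dg] := excess_drain t0 x0; have [tx|xt] := ltP t (2 * u p).
      rewrite resolvent_lt// /phi /f /u.
      by have [-> ->] := dl tx; rewrite le_eqVlt; apply/orP; left; apply/eqP; field; rewrite ?lt0r_neq0.
    rewrite resolvent_ge// /phi /f /u; have [-> ->] := dg xt.
    rewrite le_eqVlt; apply/orP; left; apply/eqP.
    by field; rewrite ?lt0r_neq0.
- move=> p x0 y0.
  apply: (le_trans (@jump_bound f p (f p) (k1 p) 0 0 _ _ _ _)) => //.
    move=> s s0; rewrite mul0r addr0 /jump.
    case: ifPn => [hs|_]; last by rewrite mul0r addr0 /f /u /excess /=.
    have sm := card_to_short_lt hs.
    have [[cx [eu ea]]|[cx [eu ea]]] := excess_cases p.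
      have -> : f (p.1 + s, p.2) = (u p + s) ^+ 3 + a * (u p + s) ^+ 2 + - b * (u p + s).
        rewrite /f /u {1 2 3}/excess /= max_l; last lra.
        by rewrite eu; congr (_ ^+ 3 + _ * _ ^+ 2 + _ * _); ring.
      rewrite /k1 ea /f; have := u0 p; set v := u p => v0.
      have q0 : 0 <= mplus - s by lra.
      have s1 : 0 <= v * (s * (mplus - s)) by apply: mulr_ge0 => //; apply: mulr_ge0.
      have s2 : 0 <= a * (s * (mplus - s)).
        by apply: mulr_ge0; [exact: ltW|apply: mulr_ge0].
      have s3 : 0 <= s * ((mplus - s) * (mplus + s)).
        by apply: mulr_ge0 => //; apply: mulr_ge0 => //; exact: addr_ge0.
      by lra.
    have fp : f p = 0 by rewrite /f /u eu; ring.
    rewrite /k1 ea fp !mul0r addr0 /f /u.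
    set v := excess c _.
    have v0 : 0 <= v by rewrite /v /excess le_max lexx orbT.
    have vm : v <= mplus by rewrite /v /excess /= ge_max; apply/andP; split; lra.
    have -> : v ^+ 3 + a * v ^+ 2 + - b * v = - (v * ((mplus - v) * (mplus + v) + a * (mplus - v))).
      by rewrite /b; ring.
    rewrite oppr_le0; apply: mulr_ge0 => //; apply: addr_ge0; apply: mulr_ge0.
    - by rewrite subr_ge0.
    - exact: addr_ge0.
    - exact: ltW.
    - by rewrite subr_ge0.
  rewrite short_loadE /psi !mul0r !addr0 /above /=.
  by [].
- move=> p x0 y0; rewrite /C /phi /f.
  have s1 : 0 <= a * (u p - b / (2 * a)) ^+ 2.
    by apply: mulr_ge0; [exact: ltW|exact: sqr_ge0].
  have s1' : a * (u p - b / (2 * a)) ^+ 2 = a * u p ^+ 2 - b * u p + b ^+ 2 / (4 * a).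
    by field; rewrite ?lt0r_neq0.
  have s2 : 0 <= u p ^+ 3 by rewrite exprn_ge0.
  have s3 : 0 <= lam^-1 * (3 / 2 * u p ^+ 2 + a * u p + - (b / 2) * above c p + b / 2).
    apply: mulr_ge0; first by rewrite invr_ge0 ltW.
    have q1 := sqr_ge0 (u p); have q2 : 0 <= a * u p by apply: mulr_ge0; [exact: ltW|exact: u0].
    by have [[_ [_ ->]]|[_ [_ ->]]] := excess_cases p; lra.
  by move: s1; rewrite s1'; lra.
- move=> p x0 y0.
  have -> : lam * (phi p - psi p) = 3 / 2 * u p ^+ 2 + a * u p + - (b / 2) * above c p -
      k1 p * short_load p.1.
    by rewrite short_loadE /phi /psi /f /above /=; field; rewrite ?lt0r_neq0.
  rewrite /D /k1.
  have [[cx [eu ea]]|[cx [eu ea]]] := excess_cases p; last first.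
    by rewrite ea /u eu; lra.
  have [[_ ->]|[cx2 _]] := short_load_cases p.1; last lra.
  rewrite ea; set v := u p; have v0 : 0 <= v by exact: u0.
  have q0 : 0 <= al^-1 by rewrite invr_ge0 ltW.
  have e1 : al * a = 3 / 4 * mplus by rewrite /a; field; rewrite ?lt0r_neq0.
  have s1 : 0 <= v * (mplus * al) by apply: mulr_ge0 => //; apply: mulr_ge0; exact: ltW.
  have s2 : 0 <= al^-1 * (mplus ^+ 2 * (2^-1 - al)).
    by apply: mulr_ge0 => //; apply: mulr_ge0; rewrite ?sqr_ge0// subr_ge0.
  have s2' : al^-1 * (mplus ^+ 2 * (2^-1 - al)) = 2^-1 * (mplus ^+ 2 / al) - mplus ^+ 2.
    by field; rewrite ?lt0r_neq0.
  have e2 : a * mplus = 3 / 4 * (mplus ^+ 2 / al) by rewrite /a; ring.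
  have e3 : al * (a * v) = 3 / 4 * mplus * v by rewrite mulrA e1.
  have e4 : al * (a * mplus) = 3 / 4 * mplus * mplus by rewrite mulrA e1.
  rewrite s2' in s2; rewrite /b; lra.
Qed.

(** * Quadratic functions of the two works *)

Let drain_pos (t w : R) : t < 2 * w -> (drain t w <= 0)%R%:R = 0 :> R.
Proof. by move=> h; rewrite drainE_lt// (_ : _ <= 0 = false) //; apply/negbTE; rewrite -ltNge; lra. Qed.

Let drain_null (t w : R) : 2 * w <= t -> (drain t w <= 0)%R%:R = 1 :> R.
Proof. by move=> h; rewrite drainE_ge// lexx mulr1n. Qed.

Let square_drain1 (b : R) (p : R * R) : 0 <= p.1 -> 0 <= p.2 ->
  \int[P]_w (2^-1 * drain (A0 w) p.1 ^+ 2 - b * drain (A0 w) p.1 +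
    lam^-1 * (2^-1 * (drain (A0 w) p.1 - b) * (1 - (drain (A0 w) p.1 <= 0)%R%:R)))
  <= 2^-1 * p.1 ^+ 2 - b * p.1.
Proof.
move=> x0 y0; set x := p.1.
pose phi (q : R * R) := 2^-1 * q.1 ^+ 2 - b * q.1 +
  lam^-1 * (2^-1 * (q.1 - b) * (1 - at_zero1 q)).
have h1 : tame 3 2 phi by tame_tac.
have -> : 2^-1 * x ^+ 2 - b * x =
    0 * (x - 0 / 2) ^+ 3 + 2^-1 * (x - 0 / 2) ^+ 2 + - b * (x - 0 / 2) by ring.
apply: (@drain_bound phi p
  (fun t => 0 * (x - t / 2) ^+ 3 + 2^-1 * (x - t / 2) ^+ 2 + - b * (x - t / 2))
  (fun t => - (3 * 0 / 2 * (x - t / 2) ^+ 2 + 2^-1 * (x - t / 2) + - b / 2)) (2 * x)) => //.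
- exact: mulr_ge0.
- by move=> t; exact: is_derive_cubic.
- have ch := @continuous_half R x.
  move=> t; apply: cvgN; apply: cvgD; last exact: cvg_cst.
  apply: cvgD; last by apply: cvgM; [exact: cvg_cst|exact: ch].
  apply: cvgM; first exact: cvg_cst.
  exact: (continuous_comp (ch t) (@exprn_continuous R 2 _)).
- move=> t t0; rewrite /phi /at_zero1 /=; have [tx|xt] := ltP t (2 * x).
    rewrite resolvent_lt// drain_pos// drainE_lt//.
    by rewrite le_eqVlt; apply/orP; left; apply/eqP; field; rewrite ?lt0r_neq0.
  rewrite resolvent_ge// drain_null// drainE_ge//.
  by rewrite le_eqVlt; apply/orP; left; apply/eqP; field; rewrite ?lt0r_neq0.
Qed.

(** The drain of one coordinate ignores the other, so this is the previous bound at the swapped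
    state. *)
Let square_drain2 (b : R) (p : R * R) : 0 <= p.1 -> 0 <= p.2 ->
  \int[P]_w (2^-1 * drain (A0 w) p.2 ^+ 2 - b * drain (A0 w) p.2 +
    lam^-1 * (2^-1 * (drain (A0 w) p.2 - b) * (1 - (drain (A0 w) p.2 <= 0)%R%:R)))
  <= 2^-1 * p.2 ^+ 2 - b * p.2.
Proof. by move=> x0 y0; exact: (@square_drain1 b (p.2, p.1)). Qed.

Let product_drain (p : R * R) : 0 <= p.1 -> 0 <= p.2 ->
  \int[P]_w (drain (A0 w) p.1 * drain (A0 w) p.2 +
    lam^-1 * (2^-1 * (drain (A0 w) p.2 * (1 - (drain (A0 w) p.1 <= 0)%R%:R) +
                     drain (A0 w) p.1 * (1 - (drain (A0 w) p.2 <= 0)%R%:R))))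
  <= p.1 * p.2.
Proof.
move=> x0 y0; set x := p.1; set y := p.2.
pose phi (q : R * R) := q.1 * q.2 +
  lam^-1 * (2^-1 * (q.2 * (1 - at_zero1 q) + q.1 * (1 - at_zero2 q))).
have h1 : tame 3 2 phi by tame_tac.
have -> : x * y = (x - 0 / 2) * (y - 0 / 2) by ring.
apply: (@drain_bound phi p (fun t => (x - t / 2) * (y - t / 2))
  (fun t => - (((x - t / 2) + (y - t / 2)) / 2)) (Num.min (2 * x) (2 * y))) => //.
- by rewrite le_min !mulr_ge0.
- by move=> t; exact: is_derive_mul_half.
- have chx := @continuous_half R x; have chy := @continuous_half R y.
  move=> t; apply: cvgN; apply: cvgM; last exact: cvg_cst.
  by apply: cvgD; [exact: chx|exact: chy].
- move=> t t0; rewrite /phi /at_zero1 /at_zero2 /=.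
  have [tx|xt] := ltP t (Num.min (2 * x) (2 * y)).
    rewrite resolvent_lt//; move: tx; rewrite lt_min => /andP[tx ty].
    rewrite !drain_pos// !drainE_lt//.
    by rewrite le_eqVlt; apply/orP; left; apply/eqP; field; rewrite ?lt0r_neq0.
  rewrite resolvent_ge//.
  have [xy|yx] := leP x y.
    have m : Num.min (2 * x) (2 * y) = 2 * x by rewrite min_l// ler_pM2l.
    rewrite m in xt *; rewrite drain_null// (drainE_ge xt).
    by rewrite le_eqVlt; apply/orP; left; apply/eqP; field; rewrite ?lt0r_neq0.
  have m : Num.min (2 * x) (2 * y) = 2 * y by rewrite min_r// ler_pM2l// ltW.
  rewrite m in xt *; rewrite (drain_null xt) (drainE_ge xt).
  by rewrite le_eqVlt; apply/orP; left; apply/eqP; field; rewrite ?lt0r_neq0.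
Qed.

(** A quadratic function of both works has no single freezing time: each square freezes when its own
    server empties, the product when the first of the two does. The parts are therefore bounded
    separately and added. *)
Let drain_bound_add (f g : R * R -> R) (p : R * R) (k l : R) :
  tame 3 2 f -> tame 3 2 g -> 0 <= p.1 -> 0 <= p.2 ->
  \int[P]_w f (drain_state (A0 w) p) <= k -> \int[P]_w g (drain_state (A0 w) p) <= l ->
  \int[P]_w (f (drain_state (A0 w) p) + g (drain_state (A0 w) p)) <= k + l.
Proof.
move=> tf tg x0 y0 fk gl; rewrite RintegralD//; last 2 first.
- exact: integrable_tame_drain.
- exact: integrable_tame_drain.
exact: lerD.
Qed.

(** Subtracting b (x + y) from (x + y)^2 / 2 charges the idleness of the long
  server: then 1(y = 0) carries x - b instead of x, and x - b <= u^2 / (4 v). *)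
Lemma mean_total_bound v : 0 < v -> exists C, forall N,
  eps * (M N fst + M N snd) - 2^-1 * M N (fun p => p.2 * at_zero1 p) -
    (8 * v)^-1 * M N (fun p => excess c p ^+ 2) -
    (2^-1 * (lam * ES2) + (c + v) * eps) * N%:R <= C.
Proof.
move=> v0; pose b := c + v.
have b0 : 0 < b by rewrite ltr_wpDl.
pose u := @excess R c.
pose f (p : R * R) := 2^-1 * (p.1 + p.2) ^+ 2 - b * (p.1 + p.2).
pose phi1 (q : R * R) := 2^-1 * q.1 ^+ 2 - b * q.1 +
  lam^-1 * (2^-1 * (q.1 - b) * (1 - at_zero1 q)).
pose phi2 (q : R * R) := 2^-1 * q.2 ^+ 2 - b * q.2 +
  lam^-1 * (2^-1 * (q.2 - b) * (1 - at_zero2 q)).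
pose phi12 (q : R * R) := q.1 * q.2 +
  lam^-1 * (2^-1 * (q.2 * (1 - at_zero1 q) + q.1 * (1 - at_zero2 q))).
pose phi q := phi1 q + (phi2 q + phi12 q).
pose psi p := f p + (lam^-1 * ((p.1 + p.2 - b) * rho) + 2^-1 * ES2).
pose yz (p : R * R) := p.2 * at_zero1 p.
pose u2 p := u p ^+ 2.
pose D p := eps * (p.1 + p.2) + (- 2^-1 * yz p + (- (8 * v)^-1 * u2 p +
   - (2^-1 * (lam * ES2) + b * eps))).
(* The first term completes the square in x + y - b; the second covers the correction by idle
   indicators, where - b / 2 is multiplied by at most 2. *)
pose C := 2^-1 * b ^+ 2 + lam^-1 * b.
have tx : tame 3 2 (@fst R R) by tame_tac.
have ty : tame 3 2 (@snd R R) by tame_tac.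
have tu : tame 3 2 u2 by tame_tac.
have tyz : tame 3 2 yz by tame_tac.
have tf : tame 3 2 f by tame_tac.
have t1 : tame 3 2 phi1 by tame_tac.
have t2 : tame 3 2 phi2 by tame_tac.
have t12 : tame 3 2 phi12 by tame_tac.
have h1 : tame 3 2 phi by tame_tac.
have h2 : tame 3 2 psi by tame_tac.
have h3 : tame 3 2 D by tame_tac.
have txy : tame 3 2 (fun p : R * R => p.1 + p.2) by tame_tac.
exists (lam * (phi (0, 0) + C)) => N.
suff : M N D <= lam * (phi (0, 0) + C).
  rewrite /D cumulative_meanD; [|tame_tac..].
  rewrite cumulative_meanD; [|tame_tac..].
  rewrite cumulative_meanD; [|tame_tac..].
  rewrite !cumulative_meanZ// cumulative_mean_cst cumulative_meanD//.
  by rewrite -/yz -/u2 -/b; apply: le_trans; rewrite le_eqVlt; apply/orP; left; apply/eqP; ring.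
apply: (@drift_telescope N phi f psi D C) => //.
- move=> p x0 y0.
  have -> : f p = (2^-1 * p.1 ^+ 2 - b * p.1) + ((2^-1 * p.2 ^+ 2 - b * p.2) + p.1 * p.2).
    by rewrite /f; field.
  apply: (drain_bound_add (f := phi1) (g := fun q => phi2 q + phi12 q)) => //.
  + tame_tac.
  + exact: square_drain1.
  + apply: (drain_bound_add (f := phi2) (g := phi12)) => //.
    * exact: square_drain2.
    * exact: product_drain.
- move=> p x0 y0.
  apply: (le_trans (@jump_bound f p (f p) (p.1 + p.2 - b) (p.1 + p.2 - b) 2^-1 _ _ _ _)) => //.
    move=> s s0; rewrite /jump /f; case: ifPn => _ /=;
      by rewrite le_eqVlt; apply/orP; left; apply/eqP; field.
  by rewrite /psi le_eqVlt; apply/orP; left; apply/eqP; ring.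
- move=> p x0 y0.
  have -> : phi p = 2^-1 * (p.1 + p.2 - b) ^+ 2 - 2^-1 * b ^+ 2 +
     lam^-1 * (2^-1 * (p.1 + p.2 - b) * ((1 - at_zero1 p) + (1 - at_zero2 p))).
    by rewrite /phi /phi1 /phi2 /phi12; field; rewrite ?lt0r_neq0.
  have s1 := sqr_ge0 (p.1 + p.2 - b).
  have s2 : 0 <= lam^-1 * (2^-1 * (p.1 + p.2 - b) * ((1 - at_zero1 p) + (1 - at_zero2 p)) + b).
    apply: mulr_ge0; first by rewrite invr_ge0 ltW.
    rewrite /at_zero1 /at_zero2; case: (p.1 <= 0); case: (p.2 <= 0);
      rewrite ?mulr1n ?mulr0n; lra.
  by rewrite /C; lra.
- move=> p x0 y0.
  have -> : lam * (phi p - psi p) = (p.1 + p.2 - b) * (eps - 2^-1 * at_zero1 p - 2^-1 * at_zero2 p) -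
       2^-1 * (lam * ES2).
    rewrite /phi /phi1 /phi2 /phi12 /psi /f rhoE.
    by field; rewrite ?lt0r_neq0.
  rewrite /D /yz /u2.
  have z1 : at_zero1 p * p.1 = 0 /\ 0 <= at_zero1 p.
    rewrite /at_zero1; case: leP => h; rewrite ?mulr0n ?mul0r// mulr1n mul1r; split => //.
    by apply/eqP; rewrite eq_le h.
  have z2 : at_zero2 p * p.2 = 0 /\ 0 <= at_zero2 p /\ at_zero2 p <= 1.
    rewrite /at_zero2; case: leP => h; rewrite ?mulr0n ?mul0r// mulr1n mul1r; split => //.
    by apply/eqP; rewrite eq_le h.
  have uv : at_zero2 p * (p.1 - b) <= (4 * v)^-1 * u p ^+ 2.
    have q : p.1 - b <= (4 * v)^-1 * u p ^+ 2.
      have pu : p.1 - b <= u p - v by rewrite /u /excess /b; have := le_max (p.1 - c) (p.1 - c) 0; rewrite lexx /=; lra.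
      apply: (le_trans pu); rewrite -subr_ge0.
      have -> : (4 * v)^-1 * u p ^+ 2 - (u p - v) = (4 * v)^-1 * (u p - 2 * v) ^+ 2.
        by field; rewrite ?lt0r_neq0.
      by apply: mulr_ge0; rewrite ?sqr_ge0// invr_ge0 mulr_ge0// ltW.
    have [n|n] := leP 0 (p.1 - b).
      by apply: le_trans q; rewrite ler_piMl//; case: z2 => _ [].
    apply: (@le_trans _ _ 0).
      by rewrite mulr_ge0_le0// ?ltW//; case: z2 => _ [].
    by apply: mulr_ge0; rewrite ?sqr_ge0// invr_ge0 mulr_ge0// ltW.
  have e8 : (8 * v)^-1 = 2^-1 * (4 * v)^-1 by field; rewrite ?lt0r_neq0.
  have bz : 0 <= b * at_zero1 p by apply: mulr_ge0; [exact: ltW|case: z1].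
  rewrite e8; case: z1 => z1 _; case: z2 => z2 _; lra.
Qed.

(** In the drift of x y, the factor of y is the drift of x, which contains - (al + be) 1(x > c); so
    y 1(x > c) is reached without knowledge of the joint law. Adding x^2 / 2 makes the factor of x
    the drift of the total work, at most 1/2, at the price of the term with [mplus]. *)
Lemma mean_snd_above_bound N :
  (al + be) * M N (fun p => p.2 * above c p) <= be * M N snd +
    2^-1 * M N (fun p => p.2 * at_zero1 p) + 2^-1 * M N fst + 2^-1 * mplus * N%:R.
Proof.
pose f (p : R * R) := 2^-1 * p.1 ^+ 2 - 0 * p.1 + p.1 * p.2.
pose phi1 (q : R * R) := 2^-1 * q.1 ^+ 2 - 0 * q.1 +
  lam^-1 * (2^-1 * (q.1 - 0) * (1 - at_zero1 q)).
pose phi12 (q : R * R) := q.1 * q.2 +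
  lam^-1 * (2^-1 * (q.2 * (1 - at_zero1 q) + q.1 * (1 - at_zero2 q))).
pose phi q := phi1 q + phi12 q.
pose sl p := 2^-1 + be - (al + be) * above c p.
pose psi p := f p + lam^-1 * ((p.1 + p.2 + 2^-1 * mplus) * sl p + p.1 * (rho - sl p)).
pose yz (p : R * R) := p.2 * at_zero1 p.
pose ya (p : R * R) := p.2 * above c p.
pose D p := (al + be) * ya p + (- be * p.2 + (- 2^-1 * yz p + (- 2^-1 * p.1 +
   - (2^-1 * mplus)))).
have tx : tame 3 2 (@fst R R) by tame_tac.
have ty : tame 3 2 (@snd R R) by tame_tac.
have tya : tame 3 2 ya by tame_tac.
have tyz : tame 3 2 yz by tame_tac.
have tf : tame 3 2 f by tame_tac.
have t1 : tame 3 2 phi1 by tame_tac.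
have t12 : tame 3 2 phi12 by tame_tac.
have h1 : tame 3 2 phi by tame_tac.
have h2 : tame 3 2 psi by tame_tac.
have h3 : tame 3 2 D by tame_tac.
suff : M N D <= 0.
  rewrite /D cumulative_meanD; [|tame_tac..].
  rewrite cumulative_meanD; [|tame_tac..].
  rewrite cumulative_meanD; [|tame_tac..].
  rewrite cumulative_meanD; [|tame_tac..].
  by rewrite !cumulative_meanZ// cumulative_mean_cst -/yz -/ya; lra.
have -> : 0 = lam * (phi (0, 0) + 0) :> R.
  by rewrite /phi /phi1 /phi12 /=; ring.
apply: (@drift_telescope N phi f psi D 0) => //.
- move=> p x0 y0.
  apply: (drain_bound_add (f := phi1) (g := phi12)) => //.
  + exact: square_drain1.
  + exact: product_drain.
- move=> p x0 y0.
  apply: (le_trans (@jump_bound f p (f p) (p.1 + p.2 + 2^-1 * mplus) p.1 0 _ _ _ _)) => //.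
    move=> s s0; rewrite /jump /f; case: ifPn => [hs|_] /=; last first.
      by rewrite le_eqVlt; apply/orP; left; apply/eqP; field.
    have := card_to_short_lt hs => sm.
    have s1 : 0 <= s * (mplus - s) by rewrite mulr_ge0// subr_ge0 ltW.
    by lra.
  rewrite short_loadE -[above c (p.1, 0)]/(above c p) /psi /sl.
  by rewrite le_eqVlt; apply/orP; left; apply/eqP; ring.
- move=> p x0 y0; rewrite oppr0.
  have z1 : 0 <= 1 - at_zero1 p.
    by rewrite /at_zero1; case: (p.1 <= 0); rewrite ?mulr1n ?mulr0n; lra.
  have z2 : 0 <= 1 - at_zero2 p.
    by rewrite /at_zero2; case: (p.2 <= 0); rewrite ?mulr1n ?mulr0n; lra.
  have l0 : 0 <= lam^-1 by rewrite invr_ge0 ltW.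
  rewrite /phi /phi1 /phi12 mul0r !subr0.
  have m1 := sqr_ge0 p.1.
  have m2 : 0 <= lam^-1 * (p.1 * (1 - at_zero1 p)) by apply: mulr_ge0 => //; exact: mulr_ge0.
  have m3 : 0 <= p.1 * p.2 by exact: mulr_ge0.
  have m4 : 0 <= lam^-1 * (p.2 * (1 - at_zero1 p)) by apply: mulr_ge0 => //; exact: mulr_ge0.
  have m5 : 0 <= lam^-1 * (p.1 * (1 - at_zero2 p)) by apply: mulr_ge0 => //; exact: mulr_ge0.
  lra.
- move=> p x0 y0.
  have -> : lam * (phi p - psi p) = p.2 * (2^-1 - 2^-1 * at_zero1 p - sl p) +
      p.1 * (eps - 2^-1 * at_zero2 p) - 2^-1 * mplus * sl p - 2^-1 * p.1 * at_zero1 p.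
    rewrite /phi /phi1 /phi12 /psi /f rhoE.
    by field; rewrite ?lt0r_neq0.
  rewrite /D /yz /ya.
  have z1 : p.1 * at_zero1 p = 0.
    rewrite /at_zero1; case: leP => h; rewrite ?mulr0n ?mulr0// mulr1n mulr1.
    by apply/eqP; rewrite eq_le h.
  have z2 : at_zero2 p <= 1.
    by rewrite /at_zero2; case: (p.2 <= 0); rewrite ?mulr1n ?mulr0n; lra.
  have s1 : 0 <= p.1 * (eps + 2^-1 * (1 - at_zero2 p)).
    by apply: mulr_ge0 => //; have := eps0; lra.
  have s2 : 0 <= mplus * (1 - sl p).
    apply: mulr_ge0 => //; rewrite /sl; have := be_le; have := al0; have := be0.
    by rewrite /above; case: (c < p.1); rewrite ?mulr1n ?mulr0n; lra.
  by rewrite /sl in s2 *; lra.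
Qed.

(** * Response times in terms of the works *)

Definition response (p : R * R) (s : R) : R :=
  if card_to_short mminus mplus c p.1 s then 2 * (p.1 + s) else 2 * (p.2 + s).

Definition tail_prob : R := \int[P]_w (if mplus <= S0 w then 1 else 0).

Lemma measurable_response : measurable_fun setT (fun z : (R * R) * R => response z.1 z.2).
Proof.
have m11 : measurable_fun setT (fun z : (R * R) * R => z.1.1).
  by apply: measurableT_comp.
have m12 : measurable_fun setT (fun z : (R * R) * R => z.1.2).
  by apply: measurableT_comp.
apply: measurable_fun_ifT.
- exact: (measurableT_comp (measurable_card_to_short mminus mplus c)
    (measurable_fun_pair m11 measurable_snd)).
- by apply: measurable_funM => //; exact: measurable_funD.
- by apply: measurable_funM => //; exact: measurable_funD.
Qed.

(** A job goes to the long server only if its size is at least [mplus] or it finds the short server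
    above [c]; the matching term then pays for the work met there. *)
Let response_le (p : R * R) s : 0 <= p.1 -> 0 <= p.2 -> 0 <= s ->
  0 <= response p s <= 2 * s + 2 * p.1 + 2 * p.2 * above c p +
    2 * p.2 * (if mplus <= s then 1 else 0).
Proof.
move=> x0 y0 s0; rewrite /response /card_to_short.
have a0 : 0 <= p.2 * above c p by rewrite mulr_ge0.
have b0 : 0 <= p.2 * (if mplus <= s then 1 else 0) by rewrite mulr_ge0//; case: ifP.
case: ifPn => h; apply/andP; split; try lra.
move: h a0 b0; rewrite negb_or -leNgt => /andP[ms]; rewrite ms /=.
rewrite negb_and -leNgt -ltNge /above => /orP[->|->] a0 b0; rewrite ?mulr1n; lra.
Qed.

Lemma integrable_response n :
  P.-integrable setT (EFin \o (fun w => response (X n w) (S n w))).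
Proof.
apply: (integrable_leR (g := fun w => (2 * (X n w).1 + 4 * (X n w).2) + 2 * (1 + S n w ^+ 2))).
- exact: (measurableT_comp measurable_response
    (measurable_fun_pair (measurable_state n) (mS n))).
- move=> w; have [x0 y0] := state_ge0 n w; have s0 := S_ge0 n w.
  have /andP[r0 r1] := response_le x0 y0 s0.
  rewrite ger0_norm//; apply: (le_trans r1).
  have s1 : S n w <= 1 + S n w ^+ 2.
    have := sqr_ge0 (S n w - 2^-1).
    have -> : (S n w - 2^-1) ^+ 2 = S n w ^+ 2 - S n w + 4^-1 by field.
    lra.
  have h1 : (X n w).2 * above c (X n w) <= (X n w).2.
    by rewrite ler_piMr// /above; case: (c < _).
  have h2 : (X n w).2 * (if mplus <= S n w then 1 else 0) <= (X n w).2.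
    by rewrite ler_piMr//; case: ifP.
  lra.
- apply: integrableDR.
    have tf : tame 3 2 (fun p : R * R => 2 * p.1 + 4 * p.2) by tame_tac.
    exact: (integrable_tame_state n tf).
  apply: integrableZR; apply: integrableDR; first exact: integrable_cstR.
  exact: integrable_sqrS.
Qed.

Let integrable_tail : P.-integrable setT (EFin \o (fun w => if mplus <= S0 w then 1 else 0 : R)).
Proof.
apply: (integrable_leR (g := fun=> 1)); last exact: integrable_cstR.
  by apply: measurable_fun_ifT => //; exact: measurable_fun_ler.
by move=> w; case: ifP; rewrite ?normr1 ?normr0.
Qed.

(** The size of a job is independent of the state it meets, so the mean of y 1(s >= mplus) factors
    through [tail_prob]. *)
Lemma sum_response_le N : \sum_(k < N) \int[P]_w response (X k w) (S k w) <=
  2 * ES * N%:R + (2 * M N fst + 2 * M N (fun p => p.2 * above c p) + 2 * tail_prob * M N snd).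
Proof.
pose ya (p : R * R) := p.2 * above c p.
pose psi p := 2 * ES + (2 * p.1 + (2 * ya p + 2 * tail_prob * p.2)).
have tx : tame 3 2 (@fst R R) by tame_tac.
have ty : tame 3 2 (@snd R R) by tame_tac.
have tya : tame 3 2 ya by tame_tac.
have h2 : tame 3 2 psi by tame_tac.
suff h : \sum_(k < N) \int[P]_w response (X k w) (S k w) <= M N psi.
  apply: (le_trans h); rewrite /psi cumulative_meanD; [|tame_tac..].
  rewrite cumulative_meanD; [|tame_tac..].
  rewrite cumulative_meanD; [|tame_tac..].
  rewrite cumulative_mean_cst !cumulative_meanZ// -/ya.
  by rewrite le_eqVlt; apply/orP; left; apply/eqP; ring.
apply: ler_sum => k _.
apply: (indep_integral_le (phi := fun z => response z.1 z.2)) => //.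
- exact: measurable_state.
- exact: measurable_response.
- exact: integrable_response.
- exact: integrable_tame_state.
move=> w /=; have [x0 y0] := state_ge0 k w.
move: (X k w) x0 y0 => p x0 y0.
have mr : measurable_fun setT (fun s : R => response p s).
  exact: (measurableT_comp measurable_response (pair1_measurable p)).
rewrite (integral_ident_distr (Y' := S0) (f := fun s => (response p s)%:E))//; last 2 first.
- by move=> B mB; exact: idS.
- exact/measurable_EFinP.
pose g w' := 2 * S0 w' + ((2 * p.1 + 2 * p.2 * above c p) +
    2 * p.2 * (if mplus <= S0 w' then 1 else 0)).
have i1 : P.-integrable setT (EFin \o (fun w' => 2 * S0 w')).
  exact: (integrableZR _ integrable_size).
have i2 : P.-integrable setT (EFin \o (fun w' => 2 * p.2 * (if mplus <= S0 w' then 1 else 0))).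
  exact: integrableZR.
have i3 := integrableDR (integrable_cstR (2 * p.1 + 2 * p.2 * above c p)) i2.
have ig : P.-integrable setT (EFin \o g) by exact: integrableDR.
have gr w' : 0 <= response p (S0 w') <= g w'.
  by have := response_le x0 y0 (S_ge0 0%N w'); rewrite /g !addrA.
apply: (@le_trans _ _ (\int[P]_w' (g w')%:E)%E).
  apply: ge0_le_integral => //.
  - by move=> w' _; rewrite lee_fin; case/andP: (gr w').
  - by apply/measurable_EFinP; exact: (measurableT_comp mr (mS 0%N)).
  - exact: measurable_int ig.
  - by move=> w' _; rewrite lee_fin; case/andP: (gr w').
rewrite EFin_Rintegral// lee_fin /g (RintegralD measurableT i1 i3).
rewrite (RintegralD measurableT (integrable_cstR _) i2) !RintegralZl//; last exact: integrable_size.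
rewrite Rintegral_cst// mean_one /psi /ya /tail_prob.
by rewrite le_eqVlt; apply/orP; left; apply/eqP; ring.
Qed.

(** Above [c] one has x = c + u, and u is at most half of (al / mplus) u^2 + mplus / al. The weight
    mplus / al is the scale of the excess u suggested by the bounds on its second moment and on the
    frequency of x > c. *)
Lemma mean_fst_bound N : M N fst <= c * N%:R +
  2^-1 * (al / mplus * M N (fun p => excess c p ^+ 2) + mplus / al * M N (above c)).
Proof.
pose u2 (p : R * R) := excess c p ^+ 2.
pose F p := c + (2^-1 * (al / mplus) * u2 p + 2^-1 * (mplus / al) * above c p).
have tx : tame 3 2 (@fst R R) by tame_tac.
have ta : tame 3 2 (above c) by tame_tac.
have tu : tame 3 2 u2 by tame_tac.
have tF : tame 3 2 F by tame_tac.
apply: (@le_trans _ _ (M N F)); last first.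
  rewrite /F cumulative_meanD; [|tame_tac..].
  rewrite cumulative_meanD; [|tame_tac..].
  rewrite !cumulative_meanZ// cumulative_mean_cst -/u2.
  by rewrite le_eqVlt; apply/orP; left; apply/eqP; ring.
apply: le_cumulative_mean => // p x0 y0; rewrite /F /u2.
have [[cx [eu ea]]|[cx [eu ea]]] := excess_cases p; rewrite eu ea; last lra.
set v := p.1 - c; have -> : p.1 = c + v by rewrite /v; ring.
rewrite lerD2l -subr_ge0.
have -> : 2^-1 * (al / mplus) * v ^+ 2 + 2^-1 * (mplus / al) * 1 - v =
  2^-1 * (al / mplus) * (v - mplus / al) ^+ 2 by field; rewrite ?lt0r_neq0.
apply: mulr_ge0; last exact: sqr_ge0.
by apply: mulr_ge0 => //; rewrite divr_ge0// ltW.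
Qed.

(** * The choice of the threshold *)

Variables (de L : R).
Hypotheses (de0 : 0 < de) (de_eps : de <= eps) (de_be : 2 * de <= be).
Hypotheses (LE : L = ln (3 / (2 * be * de))) (cE : c = 2 * mplus / be * L).

Let arg_ge : 12 <= 3 / (2 * be * de).
Proof.
have b0 := be0; have d0 := de0.
rewrite ler_pdivlMr ?mulr_gt0//.
have dq : de <= 4^-1 by move: de_be be_le; lra.
have h : be * de <= 2^-1 * 4^-1 by apply: ler_pM => //; [exact: ltW|exact: ltW|exact: be_le].
lra.
Qed.

(** From exp (- 1/4) >= 3/4 follows exp 2 <= (4/3)^8, which is below 12, while the argument of the
    logarithm is at least 12. *)
Let L_ge2 : 2 <= L.
Proof.
rewrite LE; apply: (@le_trans _ _ (ln (expR 2))); first by rewrite expRK.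
rewrite ler_ln ?posrE ?expR_gt0//; last first.
  by apply: (lt_le_trans _ arg_ge).
apply: le_trans arg_ge.
have h : expR (4^-1 : R) <= 4 / 3.
  have := expR_ge1Dx (- 4^-1 : R); rewrite expRN => h1.
  have e0 := expR_gt0 (4^-1 : R).
  have := ler_wpM2r (ltW e0) h1; rewrite mulVf ?lt0r_neq0//; lra.
rewrite (_ : 2 = 8%:R * 4^-1 :> R); last by field.
rewrite expRM_natl; apply: (@le_trans _ _ ((4 / 3) ^+ 8)).
  by apply: lerXn2r; rewrite ?nnegrE ?expR_ge0// divr_ge0.
by lra.
Qed.

Lemma mean_response_bound : exists C, forall N,
  \sum_(k < N) \int[P]_w response (X k w) (S k w) <=
  ((2 * tail_prob + 4 * (be / (al + be))) * (1 + de / eps) * (lam * ES2 / (2 * eps)) + 2 * ES +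
   44 * mplus * Num.max (be / (al ^+ 2 * (al + be)))
     (Num.max (Num.sqrt (be / (al ^+ 2 * eps * (al + be)))) (L / (be * (al + be))))) * N%:R + C.
Proof.
have etaE : expR (- (th * c)) = (2 * be * de / 3) ^+ 2.
  have -> : - (th * c) = 2 * - L by rewrite cE; field; rewrite ?lt0r_neq0.
  rewrite -[2 in LHS]/(2%:R) expRM_natl LE expRN lnK ?posrE; last first.
    by apply: (lt_le_trans _ arg_ge).
  by congr (_ ^+ 2); rewrite invf_div.
have M_ge0 f N : (forall p, 0 <= p.1 -> 0 <= p.2 -> 0 <= f p) -> 0 <= M N f.
  move=> f0; apply: sumr_ge0 => k _; apply: Rintegral_ge0 => w _.
  by have [x0 y0] := state_ge0 k w; exact: f0.
have e1_ge0 (p : R * R) : 0 <= at_zero1 p by [].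
have albe1 : al + be <= 1 by move: al_le be_le; lra.
have pl0 : 0 <= tail_prob by apply: Rintegral_ge0 => w _; case: ifP.
have pl1 : tail_prob <= 1.
  apply: (@le_trans _ _ (\int[P]_w (1 : R))); last by rewrite Rintegral_cst// mean_one mul1r.
  apply: le_Rintegral => //; first exact: integrable_cstR.
  by move=> w _; case: ifP.
have total v : 0 < v -> exists C, forall N,
    eps * (M N fst + M N snd) - 2^-1 * M N (fun p => p.2 * at_zero1 p) -
    (8 * v)^-1 * M N (fun p => excess c p ^+ 2) -
    (eps * (lam * ES2 / (2 * eps)) + (c + v) * eps) * N%:R <= C.
  move=> v0; have [C HC] := mean_total_bound v0; exists C => N.
  rewrite (_ : eps * (lam * ES2 / (2 * eps)) = 2^-1 * (lam * ES2)); first exact: HC.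
  by field; rewrite ?lt0r_neq0.
have [C HC] := @assembly_bound R al be eps de mplus lam c L (lam * ES2 / (2 * eps)) tail_prob
  (expR (- (th * c))) al0 be0 eps0 de0 mp0 al_le be_le albe1 de_eps de_be L_ge2 cE pl0 pl1 etaE
  (M^~ (@at_zero1 R)) (M^~ e) (M^~ (above c)) (M^~ (fun p => excess c p ^+ 2)) (M^~ fst) (M^~ snd)
  (M^~ (fun p => p.2 * at_zero1 p)) (M^~ (fun p => p.2 * above c p))
  (fun N => M_ge0 _ N (fun p _ _ => e1_ge0 p)) (fun N => M_ge0 _ N (fun p _ _ => expR_ge0 _))
  (fun N => M_ge0 _ N (fun p x0 _ => x0)) (fun N => M_ge0 _ N (fun p _ y0 => y0))
  mean_exp_bound mean_snd_zero1_bound mean_above_bound mean_excess_bound total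
  mean_snd_above_bound mean_fst_bound.
exists C => N; apply: (le_trans (sum_response_le N)); have := HC N; lra.
Qed.

End process.

(** * Long-run means and truncation at zero *)

(** The additive constants of the drift bounds, divided by the number of arrivals, disappear
    here. *)
Lemma limn_esup_le_approx {R : realType} (u : nat -> \bar R) (B C : R) :
  (forall n, (u n <= (B + C / n.+1%:R)%:E)%E) -> (limn_esup u <= B%:E)%E.
Proof.
move=> uB.
have cv : (fun n : nat => (B + C / n.+1%:R)%:E) @ \oo --> B%:E.
  apply: cvg_EFin; first by near=> n.
  rewrite /comp /=.
  have : (fun n : nat => B + C * n.+1%:R^-1) @ \oo --> B + C * 0.
    apply: cvgD; first exact: cvg_cst.
    by apply: cvgM; [exact: cvg_cst|exact: cvg_harmonic].
  by rewrite mulr0 addr0.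
rewrite -(cvg_limn_einf_sup cv).2 !limn_esup_lim.
apply: lee_lim.
- exact: is_cvg_esups.
- exact: is_cvg_esups.
near=> n; apply: ge_ereal_sup => _ [k /= nk <-].
apply: (le_trans (uB k)); apply: ereal_sup_ubound; by exists k.
Unshelve. all: by end_near. Qed.

Section truncation.
Context {d} {T : measurableType d} {R : realType} (P : probability T R).

(** The drift arguments take inputs that are nonnegative at every sample point, whereas those of the
    theorem are so only almost surely. Truncation at zero alters them on a null set and preserves
    independence and equality of laws. *)
Definition nneg_part (Y : nat -> T -> R) (i : nat) (w : T) : R := Num.max (Y i w) 0.

Lemma nneg_part_ge0 Y i w : 0 <= nneg_part Y i w.
Proof. by rewrite /nneg_part le_max lexx orbT. Qed.

Lemma measurable_max0 : measurable_fun setT (fun r : R => Num.max r 0).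
Proof. exact: measurable_maxr. Qed.

Lemma measurable_nneg_part Y i : measurable_fun setT (Y i) ->
  measurable_fun setT (nneg_part Y i).
Proof. by move=> mY; apply: measurable_maxr. Qed.

Lemma measurable_preimage_max0 (B : set R) : measurable B ->
  measurable ((fun r : R => Num.max r 0) @^-1` B).
Proof. by move=> mB; rewrite -[X in measurable X]setTI; exact: measurable_max0. Qed.

Lemma mutually_independent_nneg_part (A S : nat -> T -> R) :
  mutually_independent P (input_family A S) ->
  mutually_independent P (input_family (nneg_part A) (nneg_part S)).
Proof.
move=> ind F B uF mB.
have := @ind F (fun i => (fun r : R => Num.max r 0) @^-1` B i) uF
  (fun i => measurable_preimage_max0 (mB i)).
have E i : input_family (nneg_part A) (nneg_part S) i @^-1` B i =
    input_family A S i @^-1` ((fun r : R => Num.max r 0) @^-1` B i) by case: i.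
by under eq_bigr do rewrite -E; under [X in _ = X -> _]eq_bigr do rewrite -E.
Qed.

Lemma ae_nneg_part (Y : nat -> T -> R) : (forall i, measurable_fun setT (Y i)) ->
  (forall i, P [set w | Y i w < 0] = 0%E) ->
  {ae P, forall w, forall i, nneg_part Y i w = Y i w}.
Proof.
move=> mY Y0; apply: ae_foralln => i.
exists [set w | Y i w < 0]; split; [|exact: Y0|].
  rewrite (_ : [set w | _] = Y i @^-1` `]-oo, 0[).
    by rewrite -[X in measurable X]setTI; exact: mY.
  by apply/seteqP; split => w /=; rewrite in_itv.
move=> w /= h; rewrite ltNge; apply/negP => y0; apply: h.
by rewrite /nneg_part max_l.
Qed.

End truncation.

Section reduction.
Context {d} {T : measurableType d} {R : realType} (P : probability T R).
Variables (A Sz : nat -> T -> R) (mminus mplus c : R).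
Hypotheses (mA : forall i, measurable_fun setT (A i))
  (mS : forall i, measurable_fun setT (Sz i)).
Local Notation A' := (nneg_part A).
Local Notation S' := (nneg_part Sz).
Hypotheses (aeA : {ae P, forall w, forall i, A' i w = A i w})
  (aeS : {ae P, forall w, forall i, S' i w = Sz i w}).

Lemma card_responseE (a s : nat -> R) n : card_response mminus mplus c a s n =
  response mminus mplus c (card_state mminus mplus c a s n) (s n).
Proof. by []. Qed.

Lemma integral_nneg_part (g : R -> R) : measurable_fun setT g ->
  (\int[P]_w (g (Sz 0%N w))%:E = \int[P]_w (g (S' 0%N w))%:E)%E.
Proof.
move=> mg; apply: ae_eq_integral => //.
- exact/measurable_EFinP/(measurableT_comp mg).
- exact/measurable_EFinP/(measurableT_comp mg)/measurable_nneg_part.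
- by apply: filterS aeS => w /= h _; rewrite h.
Qed.

Lemma integral_card_response n :
  (\int[P]_w (card_response mminus mplus c (fun i => A i w) (fun i => Sz i w) n)%:E =
   \int[P]_w (response mminus mplus c
     (card_state mminus mplus c (A' ^~ w) (S' ^~ w) n) (S' n w))%:E)%E.
Proof.
have mr B Z (mB : forall i, measurable_fun setT (B i)) (mZ : forall i, measurable_fun setT (Z i)) :
    measurable_fun setT (fun w : T => (response mminus mplus c
      (card_state mminus mplus c (B ^~ w) (Z ^~ w) n) (Z n w))%:E).
  apply/measurable_EFinP; apply: (measurableT_comp (measurable_response mminus mplus c)
    (measurable_fun_pair _ (mZ n))).
  by apply: measurable_card_state.
apply: ae_eq_integral => //.
- exact: mr.
- by apply: mr => i; exact: measurable_nneg_part.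
apply: filterS2 aeA aeS => w hA hS _.
have eA : (fun i => A i w) = A' ^~ w by apply/funext => i; rewrite hA.
have eS : (fun i => Sz i w) = S' ^~ w by apply/funext => i; rewrite hS.
by rewrite eA eS card_responseE.
Qed.

End reduction.

(** * The bound on the long-run mean response time *)

Unset Implicit Arguments.
Set Strict Implicit.
Set Printing Implicit Defensive.

Theorem mainTheorem14 (R : realType) (d : measure_display) (T : measurableType d)
  (P : probability T R) (A Sz : nat -> T -> R)
  (lam mminus mplus c delta m : R) :
  (forall i, measurable_fun setT (A i)) ->
  (forall i, measurable_fun setT (Sz i)) ->
  mutually_independent P (input_family A Sz) ->
  0 < lam ->
  (forall i (t : R), 0 <= t -> P [set w | t < A i w] = (expR (- (lam * t)))%:E) ->
  (forall i (B : set R), measurable B -> P (Sz i @^-1` B) = P (Sz 0 @^-1` B)) ->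
  P [set w | Sz 0 w < 0] = 0%E ->
  (forall x : R, P [set w | Sz 0 w = x] = 0%E) ->
  (\int[P]_w ((Sz 0 w) ^+ 2)%:E < +oo)%E ->
  let ES := mean P (Sz 0) in
  let ES2 := mean P (fun w => (Sz 0 w) ^+ 2) in
  let rho := lam * ES in
  let eps := 1 - rho in
  let rho_s := lam * mean_below P (Sz 0) mminus in
  let rho_m := lam * mean_between P (Sz 0) mminus mplus in
  let alpha := 2^-1 - rho_s in
  let beta := rho_s + rho_m - 2^-1 in
  0 <= mminus -> mminus <= mplus -> mplus <= c ->
  0 < alpha -> 0 < beta -> 0 < delta ->
  delta <= eps -> eps < 2^-1 -> 2 * delta <= beta ->
  c = 2 * mplus / beta * ln (3 / (2 * beta * delta)) ->
  mean_below P (Sz 0) m = ES / 2 ->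
  let K := 2 * fine (P [set w | m <= Sz 0 w]) in
  let EW := lam * ES2 / (2 * eps) in
  let L := ln (3 / (2 * beta * delta)) in
  (mean_response P
     (fun n w => card_response mminus mplus c (fun i => A i w) (fun i => Sz i w) n)
   <= ((K + 4 * beta / (alpha + beta)) * (1 + delta / eps) * EW + 2 * ES
       + 44 * mplus *
         Num.max (beta / (alpha ^+ 2 * (alpha + beta)))
         (Num.max (Num.sqrt (beta / (alpha ^+ 2 * eps * (alpha + beta))))
         (Num.max (L / (beta * (alpha + beta)))
         (Num.max (Num.sqrt (L / beta))
                  (Num.sqrt delta * L / (alpha ^+ 2 * beta ^+ 2 * eps))))))%:E)%E.
Proof.
move=> mA mS ind lam0 tailA idS Sneg _ S2fin ES ES2 rho eps rho_s rho_m al be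
  mm0 mmp mpc al0 be0 de0 de_eps _ de_be cE mE.
cbv zeta; set K := 2 * fine _; set EW := lam * ES2 / _; set L := ln _.
pose A' := nneg_part A; pose S' := nneg_part Sz.
have Aneg i : P [set w | A i w < 0] = 0%E.
  have h : P [set w | 0 < A i w] = 1%E by rewrite tailA// mulr0 oppr0 expR0.
  have m0 : measurable [set w | 0 < A i w].
    rewrite (_ : [set w | _] = A i @^-1` `]0, +oo[).
      by rewrite -[X in measurable X]setTI; exact: mA.
    by apply/seteqP; split => w /=; rewrite in_itv/= andbT.
  have m1 : measurable [set w | A i w < 0].
    rewrite (_ : [set w | _] = A i @^-1` `]-oo, 0[).
      by rewrite -[X in measurable X]setTI; exact: mA.
    by apply/seteqP; split => w /=; rewrite in_itv.
  have := probability_setC P m0; rewrite h subee// => hc.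
  apply/eqP; rewrite eq_le measure_ge0 andbT -hc.
  apply: le_measure; rewrite ?inE//; first exact: measurableC.
  by move=> w /= ha hb; have := lt_trans ha hb; rewrite ltxx.
have Sneg' i : P [set w | Sz i w < 0] = 0%E.
  have e j : [set w | Sz j w < 0] = Sz j @^-1` `]-oo, 0[.
    by apply/seteqP; split => w /=; rewrite in_itv.
  by rewrite e idS// -e.
have aeA := ae_nneg_part mA Aneg.
have aeS := ae_nneg_part mS Sneg'.
have mA' i : measurable_fun setT (A' i) by exact: measurable_nneg_part.
have mS' i : measurable_fun setT (S' i) by exact: measurable_nneg_part.
have ind' := mutually_independent_nneg_part ind.
have tailA' i t : 0 <= t -> P [set w | t < A' i w] = (expR (- (lam * t)))%:E.
  move=> t0; rewrite -(tailA i t t0); congr (P _); apply/seteqP; split => w /=.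
    by rewrite /A' /nneg_part lt_max => /orP[//|]; rewrite ltNge t0.
  by rewrite /A' /nneg_part lt_max => ->.
have idS' i B : measurable B -> P (S' i @^-1` B) = P (S' 0%N @^-1` B).
  by move=> mB; exact: (idS i _ (measurable_preimage_max0 mB)).
have A'0 := nneg_part_ge0 A; have S'0 := nneg_part_ge0 Sz.
have S2 : P.-integrable setT (EFin \o (fun w => S' 0%N w ^+ 2)).
  apply/integrableP; split; first by apply/measurable_EFinP; exact: measurable_funX.
  under eq_integral do rewrite gee0_abs ?lee_fin ?sqr_ge0//.
  rewrite -(integral_nneg_part mS aeS (g := fun s => s ^+ 2))//; exact: exprn_measurable.
have mp0 : 0 <= mplus by exact: le_trans mmp.
have c0 : 0 <= c by exact: le_trans mpc.
have belowE b : mean_below P (Sz 0%N) b = \int[P]_w (if S' 0%N w < b then S' 0%N w else 0).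
  rewrite /mean_below /Rintegral.
  rewrite (integral_nneg_part mS aeS (g := fun s => if s < b then s else 0))//.
  by apply: measurable_fun_ifT => //; exact: measurable_fun_ltr.
have betweenE a b : mean_between P (Sz 0%N) a b =
    \int[P]_w (if (a <= S' 0%N w) && (S' 0%N w < b) then S' 0%N w else 0).
  rewrite /mean_between /Rintegral.
  rewrite (integral_nneg_part mS aeS (g := fun s => if (a <= s) && (s < b) then s else 0))//.
  apply: measurable_fun_ifT => //.
  by apply: measurable_and; [exact: measurable_fun_ler|exact: measurable_fun_ltr].
have ESE : ES = \int[P]_w S' 0%N w.
  by rewrite /ES /mean /Rintegral (integral_nneg_part mS aeS (g := id)).
have ES2E : ES2 = \int[P]_w (S' 0%N w ^+ 2).
  by rewrite /ES2 /mean /Rintegral (integral_nneg_part mS aeS (g := fun s => s ^+ 2))//;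
     exact: exprn_measurable.
have iS := integrable_size mS' S'0 S2.
(* Above [c] the short server receives only sizes below [mminus], at load 1/2 - al; otherwise all
   sizes below [mplus], at load 1/2 + be. *)
have slE x : short_load P S' lam mminus mplus c x = 2^-1 + be - (al + be) * above c (x, 0).
  have rs : rho_s = 2^-1 - al by rewrite /al; ring.
  have rm : rho_m = al + be by rewrite /al /be; ring.
  rewrite /short_load /above /=; case: ltP => cx.
    rewrite mulr1n mulr1 (_ : 2^-1 + be - (al + be) = rho_s); last by rewrite rs; ring.
    rewrite /rho_s belowE; congr (_ * _); apply: eq_Rintegral => w _.
    by rewrite /card_to_short (leNgt x c) cx andbF orbF.
  rewrite mulr0n mulr0 subr0 (_ : 2^-1 + be = rho_s + rho_m); last by rewrite rs rm; ring.
  rewrite /rho_s /rho_m -mulrDr belowE betweenE; congr (_ * _).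
  rewrite -RintegralD//; last 2 first.
  - by apply: (integrable_size_if mS' S'0 S2 (b := fun s => s < mminus)); exact: measurable_fun_ltr.
  - apply: (integrable_size_if mS' S'0 S2 (b := fun s => (mminus <= s) && (s < mplus))).
    by apply: measurable_and; [exact: measurable_fun_ler|exact: measurable_fun_ltr].
  apply: eq_Rintegral => w _; rewrite /card_to_short cx andbT.
  by case: (ltP (S' 0%N w) mminus) => h; rewrite ?addr0 ?add0r.
have slle := short_load_le c mS' lam0 S'0 S2 mp0 mmp.
(* With [mplus] = 0 no work could enter the short server, against the load 1/2 + be below [c]. *)
have mp_gt0 : 0 < mplus.
  rewrite lt_neqAle mp0 andbT; apply/eqP => m0.
  have := slle 0; rewrite slE -m0 mulr0 /above /= ltNge c0 mulr0n mulr0 subr0; lra.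
have eps0 : 0 < eps by exact: lt_le_trans de_eps.
have rhoE : lam * \int[P]_w S' 0%N w = 1 - eps by rewrite -ESE /eps /rho; ring.
have [C HC] := mean_response_bound mA' mS' ind' lam0 tailA' idS' A'0 S'0 S2 mp0 mmp c0
  al0 be0 eps0 mp_gt0 slE rhoE de0 de_eps de_be (erefl L) cE.
set B0 := (2 * tail_prob P S' mplus + 4 * (be / (al + be))) * (1 + delta / eps) *
  (lam * \int[P]_w (S' 0%N w ^+ 2) / (2 * eps)) + 2 * \int[P]_w S' 0%N w +
  44 * mplus * Num.max (be / (al ^+ 2 * (al + be)))
    (Num.max (Num.sqrt (be / (al ^+ 2 * eps * (al + be)))) (L / (be * (al + be)))) in HC.
apply: (@le_trans _ _ B0%:E).
  apply: (@limn_esup_le_approx _ _ B0 C) => n.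
  under eq_bigr => k _.
    rewrite (integral_card_response mminus mplus c mA mS aeA aeS).
    rewrite (EFin_Rintegral (integrable_response c mA' mS' idS' A'0 S'0 S2 mp0 mmp k)).
    over.
  rewrite sumEFin -EFinM lee_fin -ler_pdivlMl ?invr_gt0// invrK.
  rewrite mulrDr [_ * (C / _)]mulrCA divff ?pnatr_eq0// mulr1 [_ * B0]mulrC.
  exact: HC.
rewrite lee_fin /B0 -ES2E -ESE -/EW.
have EW0 : 0 <= EW.
  rewrite /EW ES2E divr_ge0 ?mulr_ge0 ?(ltW lam0) ?(ltW eps0)//.
  by apply: Rintegral_ge0 => w _; exact: sqr_ge0.
(* If [mplus] were below [m], the load 1/2 + be of the short server would be at most that of the
   sizes below [m], which is rho / 2 < 1/2. This lets the tail at [mplus] be replaced by the one at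
   [m] in [K]. *)
have m_mplus : m <= mplus.
  rewrite leNgt; apply/negP => mm.
  have h : short_load P S' lam mminus mplus c 0 <= lam * (ES / 2).
    rewrite -mE belowE ler_pM2l//; apply: le_Rintegral => //.
    - by apply: (integrable_size_if mS' S'0 S2); exact: measurable_short.
    - by apply: (integrable_size_if mS' S'0 S2 (b := fun s => s < m)); exact: measurable_fun_ltr.
    - move=> w _; case: ifPn => [hs|_]; last by case: ifP.
      by rewrite (lt_trans (card_to_short_lt mmp hs) mm).
  move: h; rewrite slE /above /= ltNge c0 mulr0n mulr0 subr0 mulrA.
  have -> : lam * ES = 1 - eps by rewrite /eps /rho; ring.
  lra.
have tpK : 2 * tail_prob P S' mplus <= K.
  rewrite /K ler_pM2l// /tail_prob /Rintegral.
  have -> : (\int[P]_w (if mplus <= S' 0%N w then 1 else 0)%:E)%E =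
      (\int[P]_w (\1_[set w | mplus <= Sz 0%N w] w)%:E)%E.
    apply: eq_integral => w _; rewrite indicE; congr (_%:E).
    rewrite /S' /nneg_part le_max (leNgt mplus 0) mp_gt0 orbF.
    by case: ifPn => h; [rewrite mem_set|rewrite memNset//; exact/negP].
  have mset (b : R) : measurable [set w | b <= Sz 0%N w].
    rewrite (_ : [set w | _] = Sz 0%N @^-1` `[b, +oo[).
      by rewrite -[X in measurable X]setTI; exact: mS.
    by apply/seteqP; split => w /=; rewrite in_itv/= andbT.
  rewrite integral_indic// setIT fine_le ?fin_num_measure//.
  apply: le_measure; rewrite ?inE// => w /=; exact: le_trans.
have s0 : 0 <= (1 + delta / eps) * EW.
  by apply: mulr_ge0 => //; rewrite addr_ge0 ?divr_ge0 ?ltW.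
have h1 : (2 * tail_prob P S' mplus + 4 * (be / (al + be))) * ((1 + delta / eps) * EW) <=
    (K + 4 * be / (al + be)) * ((1 + delta / eps) * EW).
  by apply: ler_wpM2r => //; rewrite mulrA lerD2r.
rewrite -!(mulrA _ _ EW) lerD//; first by rewrite lerD2r.
rewrite ler_wpM2l//; first by rewrite mulr_ge0.
rewrite !ge_max !le_max !lexx !orbT /=.
by [].
Qed.
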